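(* $\delta_{3,q} = \frac{3}{4}$ for $2 \leq q \leq 6$, $\delta_{3,7} = \frac{5}{7}$, $\delta_{3,8} = \frac{11}{16}$, and $\delta_{3,q} = \frac{2}{3}$ for all $q \geq 9$.
   Context: A $q$-edge-colored graph is a pair $(G,f)$ with $f: E(G) \to [q]$. For a $q$-edge-colored graph $(F,f)$, its discrepancy is the largest $t$ such that some color $c \in [q]$ appears on at least $\frac{e(F)+t}{q}$ edges of $F$. A $K_r$-tiling of a graph $G$ is a collection of vertex-disjoint copies of $K_r$ in $G$ whose vertex sets partition $V(G)$; its discrepancy is that of the edge-colored graph formed by the union of its copies. For $r \geq 3$, $q \geq 2$, $\delta_{r,q}$ is the infimum of those $\delta > 0$ for which there exists $\zeta > 0$ such that for all sufficiently large $n$, for every $n$-vertex graph $G$ with $r \mid n$ and minimum degree $\delta(G) \geq \delta n$, and every coloring $f: E(G) \to [q]$, there is a $K_r$-tiling of $G$ whose discrepancy (with respect to $f$) is at least $\zeta n$. *)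

(* Defs.v *)
From mathcomp Require Import all_boot all_order all_algebra.
From mathcomp Require Import boolp classical_sets reals.

Set Implicit Arguments.
Unset Strict Implicit.
Unset Printing Implicit Defensive.
Import Order.TTheory GRing.Theory Num.Theory.
Local Open Scope set_scope.
Local Open Scope ring_scope.

Record sgraph (V : finType) := SGraph {
  adj :> rel V;
  adj_sym : symmetric adj;
  adj_irr : irreflexive adj }.

Section Graphs.
Variable V : finType.
Implicit Types (G F : sgraph V) (P : {set {set V}}).

(* An edge xy is the unordered pair [set x; y] *)
Definition edges G : {set {set V}} :=
  [set e : {set V} | [exists x, exists y, G x y && (e == [set x; y])]]%SET.

Definition degree G (v : V) : nat := #|[set w | G v w]%SET|.

(* The unit #|V| is above every degree, so for nonempty V this is the minimum *)
Definition min_degree G : nat := \big[minn/#|V|]_(v : V) degree G v.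

(* A copy of K_r in G is represented by its vertex set *)
Definition is_Kr_copy G (r : nat) (B : {set V}) : bool :=
  (#|B| == r) && [forall x in B, forall y in B, (x != y) ==> G x y].

Definition is_Kr_tiling G (r : nat) P : bool :=
  finset.partition P [set: V]%SET && [forall B in P, is_Kr_copy G r B].

Definition tiling_adj P : rel V :=
  fun x y => (x != y) && [exists B in P, (x \in B) && (y \in B)].

Lemma tiling_adj_sym P : symmetric (tiling_adj P).
Proof.
move=> x y; rewrite /tiling_adj eq_sym; congr (_ && _).
by apply: eq_existsb => B; rewrite [X in _ && X]andbC.
Qed.

Lemma tiling_adj_irr P : irreflexive (tiling_adj P).
Proof. by move=> x; rewrite /tiling_adj eqxx. Qed.

(* The union of the complete graphs on the members of P *)
Definition tiling_graph P : sgraph V :=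
  SGraph (@tiling_adj_sym P) (@tiling_adj_irr P).

(* A q-edge-coloring is given by a function on all sets of vertices; only its
   values on edges are ever used, and for q > 0 every coloring of the edges
   extends to such a function. *)
Definition color_class (q : nat) F (f : {set V} -> 'I_q) (c : 'I_q)
    : {set {set V}} :=
  [set e in edges F | f e == c]%SET.

(* For q > 0 the set is nonempty and the supremum is attained *)
Definition discrepancy (R : realType) (q : nat) F (f : {set V} -> 'I_q) : R :=
  sup [set t : R | exists c : 'I_q,
         (#|edges F|%:R + t) / q%:R <= #|color_class F f c|%:R]%classic.

End Graphs.

Definition forces_discrepancy (R : realType) (r q : nat) (delta : R) : Prop :=
  exists2 zeta : R, 0 < zeta &
  exists N : nat, forall n : nat, (N <= n)%N -> (r %| n)%N ->
  forall (G : sgraph 'I_n), delta * n%:R <= (min_degree G)%:R ->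
  forall f : {set 'I_n} -> 'I_q,
  exists2 P : {set {set 'I_n}}, is_Kr_tiling G r P &
    zeta * n%:R <= discrepancy R (tiling_graph P) f.

Definition delta_threshold (R : realType) (r q : nat) : R :=
  inf [set delta : R | 0 < delta /\ forces_discrepancy r q delta]%classic.

(* Main.v *)
(* Upper bounds. Let every tiling have discrepancy o(n). Then there are only
   o(n) disjoint gadgets, that is, sets of at most 12 vertices with two tilings
   of different color counts, since retiling them changes a color count; after
   the removal of a maximal family of gadgets the rest is rigid: for every color
   c there is a vertex weight phi_c whose sum over each triangle is the number
   of its edges of color c, so that c has sum_v phi_c(v) edges in every tiling.
   Let d > 2n/3 be the minimum degree.
   - If some K_4 has a vertex e none of whose three colors occurs in the opposite
     triangle, let S be the set of the colors of that triangle. The sum of the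
     phi_c, c in S, is 1 on N(e) and at least -1 everywhere, so that some color
     has at least (2d - n)/|S| >= (2d - n)/3 edges.
   - Otherwise, let Q be a K_4 and S the set of its colors, |S| <= 6. A vertex
     with k neighbors in Q has weight at least k - 2 if there is no K_5, which
     sums up to 4d - 2n; a K_5 must be monochromatic and then |S| = 1.
   - If d > 3n/4, there is a K_5, and this yields a color with at least
     2d - n > n/2 edges.
   Tilings exist for d > (2/3 + eta)n by a direct augmentation argument that leaves O(1) vertices,
   together with absorption.

   Lower bounds. Below 2n/3 there may be an independent set of more than n/3
   vertices, hence no tiling. In a complete 4-partite graph with three equal
   parts and a fourth part Z that is at least as large, color the pairs of the three parts with three colors
   (with repetitions if q = 2) and the edges at z in Z with a color of z. The
   graph is rigid, and the color classes of Z can be chosen such that all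
   tilings are perfectly balanced. *)
Require Import Defs.
From mathcomp Require Import all_boot all_order all_algebra.
From mathcomp Require Import boolp zify lra.

Set Implicit Arguments.
Unset Strict Implicit.
Unset Printing Implicit Defensive.
Import Order.TTheory GRing.Theory Num.Theory.

(** * Counting and pigeonhole tools *)

Lemma sum_le_count (T : Type) (s : seq T) (F : T -> nat) a b :
  (forall t, F t <= a + b) ->
  \sum_(t <- s) F t <= a * size s + b * count (fun t => a < F t) s.
Proof.
move=> h; elim: s => [|t s IH]; first by rewrite big_nil.
rewrite big_cons /=; have := h t; case: ltnP => /=; nia.
Qed.

Lemma two_in_filter (T : eqType) (m : seq T) (P : pred T) :
  1 < count P m -> exists e1 e2 m', [/\ perm_eq m [:: e1, e2 & m'], P e1 & P e2].
Proof.
rewrite -size_filter; case E: (filter P m) => [|e1 [|e2 r]] // _.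
exists e1, e2, (r ++ filter (predC P) m); split.
- by rewrite -!cat_cons -E perm_sym perm_filterC.
- have : e1 \in filter P m by rewrite E mem_head.
  by rewrite mem_filter => /andP[].
- have : e2 \in filter P m by rewrite E !inE eqxx orbT.
  by rewrite mem_filter => /andP[].
Qed.

(** Double counting: there are more incident pairs than members of [s]. It will supply one triangle
    of a packing on which two outside edges, or two outside vertices, can act together. *)
Lemma exists_double (T U : eqType) (s : seq T) (m : seq U) (P : T -> U -> bool) :
  size s < \sum_(e <- m) count (P^~ e) s ->
  exists2 t, t \in s & 1 < count (P t) m.
Proof.
move=> h; have : size s < \sum_(t <- s) count (P t) m.
  apply: (leq_trans h); rewrite leq_eqVlt; apply/orP; left; apply/eqP.
  have cE (T' : Type) (Q : pred T') r : count Q r = \sum_(t <- r) (Q t : nat).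
    by elim: r => [|t r IH]; rewrite ?big_nil ?big_cons //= IH.
  under eq_bigr do rewrite cE; rewrite exchange_big /=.
  by apply: eq_bigr => t _; rewrite cE.
move=> {}h; case: (boolP (has (fun t => 1 < count (P t) m) s)) => [/hasP|/hasPn H].
  by case=> t ? ?; exists t.
exfalso; move: h; rewrite ltnNge => /negP; apply.
elim: s H => [|t s IH] H; rewrite ?big_nil // big_cons /=.
have := H t (mem_head _ _); rewrite -leqNgt => h1.
have := IH (fun x xs => H x (mem_behead (xs : x \in behead (t :: s)))); lia.
Qed.

Lemma perm_all_eq (T : eqType) (a : pred T) (s1 s2 : seq T) :
  perm_eq s1 s2 -> all a s1 = all a s2.
Proof. by move=> h; apply: perm_all. Qed.

(** * Packings of triangles *)

Section Packings.
Variables (V : finType) (G : sgraph V).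
Implicit Types (W L : {set V}) (s : seq (V * V * V)) (m : seq (V * V)).

Definition nbr W v := [set w in W | G v w].
Definition dg W v := #|nbr W v|.
Definition tri (t : V * V * V) := [&& G t.1.1 t.1.2, G t.1.1 t.2 & G t.1.2 t.2].
Arguments tri t : simpl never.
Definition flat s := flatten [seq [:: t.1.1; t.1.2; t.2] | t <- s].
Definition flat2 m := flatten [seq [:: e.1; e.2] | e <- m].
Definition packing s W := [&& all tri s, uniq (flat s) & all (mem W) (flat s)].
Definition tileable W := exists2 s, all tri s & perm_eq (flat s) (enum W).

Lemma flat_cat s1 s2 : flat (s1 ++ s2) = flat s1 ++ flat s2.
Proof. by rewrite /flat map_cat flatten_cat. Qed.

Lemma flat_cons t s : flat (t :: s) = [:: t.1.1, t.1.2, t.2 & flat s].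
Proof. by []. Qed.

Lemma flat2_cons e m : flat2 (e :: m) = [:: e.1, e.2 & flat2 m].
Proof. by []. Qed.

Lemma size_flat s : size (flat s) = 3 * size s.
Proof. by elim: s => // t s IH; rewrite flat_cons /= IH; lia. Qed.

Lemma size_flat2 m : size (flat2 m) = 2 * size m.
Proof. by elim: m => // t m IH; rewrite flat2_cons /= IH; lia. Qed.

Lemma perm_flat s1 s2 : perm_eq s1 s2 -> perm_eq (flat s1) (flat s2).
Proof. by move=> h; apply: perm_flatten; apply: perm_map. Qed.

Lemma perm_flat2 m1 m2 : perm_eq m1 m2 -> perm_eq (flat2 m1) (flat2 m2).
Proof. by move=> h; apply: perm_flatten; apply: perm_map. Qed.

Lemma sgC x y : G x y = G y x. Proof. exact: adj_sym. Qed.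
Lemma sgN x y : G x y -> x != y.
Proof. by apply: contraL => /eqP ->; rewrite adj_irr. Qed.

Definition dT x (t : V * V * V) := G x t.1.1 + G x t.1.2 + G x t.2.
Definition left W s := [set w in W | w \notin flat s].

Lemma dg_split W s x : packing s W ->
  dg W x = dg (left W s) x + \sum_(t <- s) dT x t.
Proof.
case/and3P => _ us /allP sW.
have -> : \sum_(t <- s) dT x t = count (G x) (flat s).
  elim: s {us sW} => [|t s IH]; first by rewrite big_nil.
  by rewrite big_cons IH flat_cons /= /dT !addnA.
rewrite -size_filter -(card_uniqP (filter_uniq _ us)).
rewrite /dg /nbr -(cardID (mem (flat s)) [set w in W | G x w]) addnC.
congr (_ + _); apply: eq_card => v; rewrite !inE.
  by case: (v \in flat s); rewrite ?andbF ?andbT.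
rewrite mem_filter; case vs: (v \in flat s); rewrite ?andbF //= andbT.
have vW : v \in W by apply: sW; rewrite vs.
by rewrite vW andbT.
Qed.

Lemma card_left W s : packing s W -> #|W| = #|left W s| + 3 * size s.
Proof.
case/and3P => _ us /allP sW; rewrite -size_flat -(card_uniqP us).
rewrite -(cardID (mem (flat s)) W) addnC.
congr (_ + _); apply: eq_card => v; rewrite !inE.
  by rewrite andbC.
case vs: (v \in flat s); rewrite ?andbF //= andbT.
by apply: sW; rewrite vs.
Qed.

Lemma in_left W s v : (v \in left W s) = (v \in W) && (v \notin flat s).
Proof. by rewrite !inE. Qed.

Definition pack2 W s m :=
  [&& all tri s, all (fun e => G e.1 e.2) m, uniq (flat s ++ flat2 m)
    & all (mem W) (flat s ++ flat2 m)].

Lemma pack2_packing W s m : pack2 W s m -> packing s W.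
Proof.
case/and4P => ts _; rewrite cat_uniq all_cat /packing ts => /andP[-> _].
by move=> /andP[-> _].
Qed.

Lemma pack2_left W s m : pack2 W s m -> {subset flat2 m <= left W s}.
Proof.
case/and4P => _ _; rewrite cat_uniq all_cat => /and3P[_ /hasPn h _].
case/andP=> _ /allP hW v vm; rewrite in_left (h _ vm) andbT; exact: hW.
Qed.

Lemma pack2_perm W s m l r : uniq l -> all (mem W) l ->
  all tri s -> all (fun e => G e.1 e.2) m -> perm_eq (flat s ++ flat2 m ++ r) l ->
  pack2 W s m.
Proof.
move=> ul aW ts em pl; rewrite /pack2 ts em /=.
move: ul; rewrite -(perm_uniq pl) catA cat_uniq => /and3P[-> _ _] /=.
by move: aW; rewrite -(perm_all_eq _ pl) catA => /allP h; apply/allP => v vs;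
  apply: h; rewrite mem_cat vs.
Qed.

(** A matching in [W] has at most [|W|] edges, so the weight [|W| + 1] of a triangle encodes the
    lexicographic order: first the number of triangles is maximized, then the number of extra
    edges. *)
Lemma exists_max_pack2 W : exists s m, pack2 W s m /\
  forall s' m', pack2 W s' m' ->
    size s' * #|W|.+1 + size m' <= size s * #|W|.+1 + size m.
Proof.
pose P k := `[< exists s m, pack2 W s m /\ k = size s * #|W|.+1 + size m >].
have P0 : exists k, P k.
  by exists 0; apply/asboolP; exists [::], [::].
have Pb k : P k -> k <= #|W| * #|W|.+1 + #|W|.
  move=> /asboolP [s [m [/and4P[_ _ um /allP mL] ->]]].
  have : #|flat s ++ flat2 m| <= #|W| by apply/subset_leq_card/subsetP.
  rewrite (card_uniqP um) size_cat size_flat2 size_flat; nia.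
case: (ex_maxnP P0 Pb) => k /asboolP [s [m [psm ->]]] mx.
by exists s, m; split=> // s' m' h; apply: mx; apply/asboolP; exists s', m'.
Qed.

End Packings.

(** For the two ends of a matching edge, [l1], [l2] count the neighbors outside the packing of [k]
    triangles and [s1], [s2] those inside; [c] counts the triangles that receive more than 4 of the
    6 possible edges. At most [L] edges go outside, so the degree surplus makes [c] exceed [k/h]. *)
Lemma edge_surplus h w L k d1 d2 l1 l2 s1 s2 c :
  (2 * h + 1) * w <= 3 * h * d1 -> (2 * h + 1) * w <= 3 * h * d2 ->
  d1 = l1 + s1 -> d2 = l2 + s2 -> l1 + l2 <= L -> s1 + s2 <= 4 * k + 2 * c ->
  w = L + 3 * k -> 3 * h < L -> k < h * c.
Proof.
move=> H1 H2 E1 E2 H3 H4 E H5; subst.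
have : 3 * h * (l1 + s1 + (l2 + s2)) <= 3 * h * (L + (4 * k + 2 * c)).
  by rewrite leq_mul2l; apply/orP; right; lia.
rewrite !mulnDr in H1 H2 *; nia.
Qed.

(** The same for a leftover vertex outside the matching: its outside neighbors lie on [a < h]
    matching edges, and [c] counts the triangles to which it is completely joined. *)
Lemma vertex_surplus h w L k d l a s c :
  (2 * h + 1) * w <= 3 * h * d -> d = l + s -> l <= 2 * a -> a < h ->
  s <= 2 * k + 1 * c -> w = L + 3 * k -> 3 * h < L -> k < h * c.
Proof.
move=> H1 E1 H2 Ha H4 E H5; subst.
have : 3 * h * (l + s) <= 3 * h * (2 * h + (2 * k + c)).
  by rewrite leq_mul2l; apply/orP; right; lia.
have : h * (3 * h) <= h * L by rewrite leq_mul2l (ltnW H5) orbT.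
rewrite !mulnDr in H1 *; nia.
Qed.

Lemma sum_surplus (T : eqType) (m : seq T) (F : T -> nat) h k : h <= size m ->
  (forall e, e \in m -> k < h * F e) -> 0 < h -> k < \sum_(e <- m) F e.
Proof.
move=> hm H h0; have : size m * k.+1 <= h * \sum_(e <- m) F e.
  elim: m H {hm} => [|e m IH] H; rewrite ?big_nil // big_cons /=.
  have := H e (mem_head _ _).
  have := IH (fun x xs => H x (mem_behead (xs : x \in behead (e :: m)))).
  rewrite mulnDr mulSn; lia.
move=> {H} H; rewrite -(leq_pmul2l h0); apply: leq_trans H.
by rewrite leq_mul2r hm orbT.
Qed.

(** * Near-perfect triangle packings by augmentation *)

Section NearPerfect.
Variables (V : finType) (G : sgraph V).
Implicit Types (W L : {set V}) (s : seq (V * V * V)) (m : seq (V * V)).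

(** With 5 of 6 edges present, one of [y'], [z'] sees all of [t], while [y] and [z] have a common
    neighbor [u] in [t]. So [u] completes [yz] to a triangle, and the rest of [t] is completed by
    [y'] or [z']. *)
Lemma two_triangles (y z y' z' : V) t : G y z -> tri G t ->
  4 < dT G y t + dT G z t -> 4 < dT G y' t + dT G z' t ->
  exists x x' u p q, [/\ perm_eq [:: x; x'] [:: y'; z'],
    perm_eq [:: u; p; q] [:: t.1.1; t.1.2; t.2], tri G (y, z, u) & tri G (x, p, q)].
Proof.
case: t => [[a b] c]; rewrite /dT /tri /= => yz /and3P[ab ac bc] h1 h2.
have [x [x' [pxx xa xb xc]]] : exists x x',
    [/\ perm_eq [:: x; x'] [:: y'; z'], G x a, G x b & G x c].
  case: (boolP [&& G y' a, G y' b & G y' c]) => [/and3P[? ? ?]|hy].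
    by exists y', z'; split.
  exists z', y'; split; [by apply/permP => P; rewrite /= addnCA | | |];
    by move: hy h2; case: (G y' a); case: (G y' b); case: (G y' c);
    case: (G z' a); case: (G z' b); case: (G z' c).
have {h1} : [|| G y a && G z a, G y b && G z b | G y c && G z c].
  by move: h1; case: (G y a); case: (G y b); case: (G y c);
    case: (G z a); case: (G z b); case: (G z c).
case/or3P=> /andP[yu zu]; exists x, x'; [exists a, b, c|exists b, a, c|exists c, a, b];
  rewrite /tri /= ?yz ?yu ?zu ?xa ?xb ?xc ?ab ?ac ?bc; split=> //.
- by apply/permP => P; rewrite /= addnCA.
- by apply/permP => P; rewrite /= addnCA; congr (_ + _); rewrite addnCA.
Qed.

(** Take a lexicographically maximal pair of a triangle packing and a matching on the leftover. If
    more than [3h] vertices were left over, one of two exchanges would improve it, depending on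
    whether the matching has at least [h] edges. *)
Lemma near_perfect_packing W h : 0 < h -> 0 < #|W| ->
  (forall v, v \in W -> (2 * h + 1) * #|W| <= 3 * h * dg G W v) ->
  exists2 s, packing G s W & #|left W s| <= 3 * h.
Proof.
move=> h0 W0 dW; have [s [m [psm mx]]] := exists_max_pack2 G W.
have ps := pack2_packing psm; exists s => //; rewrite leqNgt; apply/negP => lL.
have cW := card_left ps; set k := size s in cW; set L := left W s in lL cW.
have mL : {subset flat2 m <= L} by exact: pack2_left psm.
have LW v : v \in L -> v \in W by rewrite /L in_left => /andP[].
have [ts em usm Wsm] := and4P psm; have [_ us Ws] := and3P ps.
have m_le : 2 * size m <= #|W|.
  have : #|flat2 m| <= #|W| by apply/subset_leq_card/subsetP => v /mL /LW.
  by move: usm; rewrite cat_uniq => /and3P[_ _ um]; rewrite (card_uniqP um) size_flat2.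
have addL v : v \in L -> v \notin flat2 m ->
    uniq (v :: flat s ++ flat2 m) /\ all (mem W) (v :: flat s ++ flat2 m).
  move=> vL vm; have := vL; rewrite /L in_left => /andP[vW vs].
  by rewrite /= usm mem_cat (negbTE vm) (negbTE vs) vW.
(* Large matching: each edge is rich towards more than [k/h] triangles, so some triangle is rich for
   two edges and [two_triangles] replaces it by two triangles. *)
case: (leqP h (size m)) => hm.
  have fulle e : e \in m ->
      k < h * count (fun t => 4 < dT G e.1 t + dT G e.2 t) s.
    move=> emm; have ee := allP em _ emm.
    have [e1L e2L] : e.1 \in L /\ e.2 \in L.
      by split; apply: mL; apply/flattenP; exists [:: e.1; e.2];
        rewrite ?inE ?eqxx ?orbT //; apply: map_f.
    have d1 := dg_split e.1 ps; have d2 := dg_split e.2 ps.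
    have dL : dg G L e.1 + dg G L e.2 <= #|L|.
      rewrite /dg -cardsUI (_ : _ :&: _ = finset.set0) ?cards0 ?addn0.
        by apply/subset_leq_card/subsetP => v; rewrite !inE => /orP[] /andP[].
      apply/setP => v; rewrite !inE; apply/negbTE/negP => /andP[/andP[vL v1] /andP[_ v2]].
      have tn : tri G (e.1, e.2, v) by rewrite /tri /= ee v1 v2.
      have v12 : uniq [:: e.1; e.2; v].
        by rewrite /= !inE !negb_or (sgN ee) (sgN v1) (sgN v2).
      (* A common leftover neighbor would give one more triangle; this is a gain even if the whole
         matching is dropped. *)
      have : pack2 G W ((e.1, e.2, v) :: s) [::].
        apply: (@pack2_perm _ _ _ _ _ ([:: e.1; e.2; v] ++ flat s) [::]) => //.
        - rewrite cat_uniq v12 us andbT /=.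
          apply/hasPn => u u_s; rewrite !inE; apply/negP => /or3P[] /eqP uE.
          + by move: e1L; rewrite /L in_left -uE u_s andbF.
          + by move: e2L; rewrite /L in_left -uE u_s andbF.
          + by move: vL; rewrite -uE u_s andbF.
        - rewrite all_cat Ws andbT /= !LW // /L in_left; exact: vL.
        - by rewrite /= tn.
        - by rewrite flat_cons /= !cats0.
      by move/mx; rewrite /= mulSn; move: m_le W0; clear; lia.
    have := @sum_le_count _ s (fun t => dT G e.1 t + dT G e.2 t) 4 2.
    rewrite big_split /= -/k => H.
    have {}H : \sum_(t <- s) dT G e.1 t + \sum_(t <- s) dT G e.2 t <=
       4 * k + 2 * count (fun t => 4 < dT G e.1 t + dT G e.2 t) s.
      by apply: H => t; rewrite /dT; clear; lia.
    exact: (edge_surplus (dW _ (LW _ e1L)) (dW _ (LW _ e2L)) d1 d2 dL H cW lL).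
  have : size s < \sum_(e <- m) count (fun t => 4 < dT G e.1 t + dT G e.2 t) s.
    exact: sum_surplus fulle h0.
  case/exists_double => t t_s /two_in_filter [[y z] [[y' z'] [m' [pm /= h1 h2]]]].
  have ps' := perm_to_rem t_s; set s' := rem t s in ps'.
  move: (ts) (em); rewrite (perm_all_eq _ ps') (perm_all_eq _ pm) /=.
  case/andP=> tt ts' /and3P[yz _ em'].
  have [x [x' [u [p [q [px pu ty tx]]]]]] := two_triangles yz tt h1 h2.
  have : pack2 G W [:: (y, z, u), (x, p, q) & s'] [::].
    apply: (@pack2_perm _ _ _ _ _ (flat s ++ flat2 m) (x' :: flat2 m')) => //.
      by rewrite /= ty tx.
    apply/permP => P; move/permP: px => /(_ P); move/permP: pu => /(_ P).
    move/permP: (perm_flat ps') => /(_ P); move/permP: (perm_flat2 pm) => /(_ P).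
    rewrite !flat_cons ?flat2_cons !count_cat /= ?count_cat /=; clear; lia.
  move/mx => /=; have := perm_size ps' => /= ->; rewrite !mulSn.
  by move: m_le; clear; lia.
(* Small matching: more than [h] leftover vertices are unmatched, so some triangle [abc] is
   completely joined to two of them, [x] and [x']. Exchanging it for [xbc] and the matching edge
   [ax'] keeps the number of triangles and gains an edge. *)
pose I := [set v in L | v \notin flat2 m].
have cI : #|L| <= #|I| + 2 * size m.
  rewrite -size_flat2.
  have : #|L :\: I| <= size (flat2 m).
    apply: leq_trans (card_size _); apply/subset_leq_card/subsetP => v.
    by rewrite !inE; case: (v \in flat2 m) => //=; rewrite andbT andNb.
  move: (cardsID I L) (subset_leq_card (subsetIr L I)); clear; lia.
have fullI x : x \in I -> k < h * count (fun t => 2 < dT G x t) s.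
  rewrite inE => /andP[xL xm]; have dd := dg_split x ps.
  have dL : dg G L x <= 2 * size m.
    rewrite -size_flat2; apply: leq_trans (card_size _).
    apply/subset_leq_card/subsetP => v; rewrite inE => /andP[vL xv].
    apply/negPn/negP => vm.
    have [u1 a1] := addL _ xL xm; have [_ a2] := addL _ vL vm.
    have : pack2 G W s ((x, v) :: m).
      apply: (@pack2_perm _ _ _ _ _ [:: v, x & flat s ++ flat2 m] [::]) => //.
      - rewrite cons_uniq u1 inE negb_or eq_sym (sgN xv) mem_cat negb_or vm andbT.
        by move: vL; rewrite /L in_left => /andP[_ ->].
      - by apply/andP; split; [case/andP: a2 | exact: a1].
      - by rewrite /= xv.
      - by apply/permP => P; rewrite cats0 flat2_cons /= !count_cat /=; clear; lia.
    by move/mx; rewrite /=; clear; lia.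
  have := @sum_le_count _ s (fun t => dT G x t) 2 1 => H.
  have {}H : \sum_(t <- s) dT G x t <= 2 * k + 1 * count (fun t => 2 < dT G x t) s.
    by apply: H => t; rewrite /dT; clear; lia.
  exact: (vertex_surplus (dW _ (LW _ xL)) dd dL hm H cW lL).
have : size s < \sum_(x <- enum I) count (fun t => 2 < dT G x t) s.
  apply: (@sum_surplus _ _ _ h) => //.
    by rewrite -cardE; move: cI hm lL; clear; lia.
  by move=> x; rewrite mem_enum; exact: fullI.
case/exists_double => t t_s /two_in_filter [x [x' [m' [pm /= h1 h2]]]].
have ps' := perm_to_rem t_s; set s' := rem t s in ps'.
have : uniq [:: x, x' & m'] by rewrite -(perm_uniq pm) enum_uniq.
have : x \in enum I by rewrite (perm_mem pm) !inE eqxx.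
have : x' \in enum I by rewrite (perm_mem pm) !inE eqxx orbT.
rewrite !mem_enum ![_ \in I]inE => /andP[x'L x'm] /andP[xL xm] /=.
rewrite inE negb_or => /andP[/andP[nxx _] _].
have [u1 a1] := addL _ xL xm; have [_ a2] := addL _ x'L x'm.
move: (ts); rewrite (perm_all_eq _ ps') => /= /andP[tt ts'].
rewrite /s' in ps' ts'; case: t tt t_s h1 h2 {s'} ps' ts' => [[a b] c]; rewrite /dT /tri /=.
move=> /and3P[ab ac bc] t_s h1 h2 ps' ts'; set s' := rem _ s in ps' ts'.
have [xa xb xc] : [/\ G x a, G x b & G x c] by move: h1; case: (G x a); case: (G x b); case: (G x c).
have [xa' xb' xc'] : [/\ G x' a, G x' b & G x' c] by move: h2; case: (G x' a); case: (G x' b); case: (G x' c).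
have : pack2 G W ((x, b, c) :: s') ((a, x') :: m).
  apply: (@pack2_perm _ _ _ _ _ [:: x', x & flat s ++ flat2 m] [::]) => //.
  - rewrite cons_uniq u1 inE negb_or eq_sym nxx mem_cat negb_or x'm andbT.
    by move: x'L; rewrite /L in_left => /andP[_ ->].
  - by apply/andP; split; [case/andP: a2 | exact: a1].
  - by rewrite /= /tri /= xb xc bc.
  - by rewrite /= sgC xa'.
  apply/permP => P; move/permP: (perm_flat ps') => /(_ P).
  rewrite !flat_cons ?flat2_cons !count_cat /= ?count_cat /=; clear; lia.
by move/mx => /=; have := perm_size ps' => /= ->; clear; lia.
Qed.
End NearPerfect.

(** * Absorption *)

(** Bernoulli's inequality for [(1 + 1/m)^k] with denominators cleared; for [k = m] it shows that
    [m] factors [(m + 1)/m] are worth at least 2. *)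
Lemma expn_succ_bound m k : (m + k) * m ^ k <= m * m.+1 ^ k.
Proof.
elim: k => [|k IH]; first by rewrite addn0 !expn0.
rewrite [m.+1 ^ k.+1]expnS [m ^ k.+1]expnS; move: IH; set x := m ^ k; set y := _ ^ k => IH.
have : m.+1 * ((m + k) * x) <= m.+1 * (m * y) by rewrite leq_mul2l IH orbT.
by nia.
Qed.

Lemma cube_lt_exp2 C : exists N, forall t, N <= t -> (C * t.+1) ^ 3 < 2 ^ t.
Proof.
exists (6 * (6 * C.+1)) => t ht; pose r := t %/ 6.
have hr : 6 * C.+1 <= r by rewrite /r leq_divRL // mulnC.
have e1 : 2 ^ (6 * r) <= 2 ^ t by rewrite leq_exp2l // mulnC leq_trunc_div.
have e2 : (r.+1 ^ 2) ^ 3 <= 2 ^ (6 * r).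
  rewrite -expnM (mulnC 6) [2 ^ _]expnM (_ : 2 * 3 = 6) // leq_exp2r //.
  exact: ltn_expl.
apply: leq_trans e1; apply: leq_trans e2; rewrite ltn_exp2r // -mulnn.
have : t < 6 * r.+1 by rewrite /r mulnC ltn_ceil.
by move: hr; clear; nia.
Qed.

(** With [m = b - 1], the ratio of the two powers is at least [2 ^ t], where [t] grows linearly in
    [w], and [2 ^ t] outgrows every cubic. *)
Lemma exp_beats_cube b K : 1 < b -> 0 < K ->
  exists N, forall w, N <= w -> b.-1 ^ (w %/ K) * w ^ 3 < b ^ (w %/ K).
Proof.
case: b => [|[|m']] // _ K0; rewrite succnK; set m := m'.+1.
have [N HN] := cube_lt_exp2 (2 * (K * m)).
exists (N.+1 * (K * m)) => w hw; set s := w %/ K; pose t := s %/ m.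
have ht : N.+1 <= t by rewrite /t /s -divnMA leq_divRL // muln_gt0 K0.
have ws : w < K * s.+1 by rewrite mulnC /s ltn_ceil.
have st : s < m * t.+1 by rewrite mulnC /t ltn_ceil.
have hwt : w <= 2 * (K * m) * t.+1.
  apply: leq_trans (ltnW ws) _.
  have -> : 2 * (K * m) * t.+1 = K * (2 * (m * t.+1)) by rewrite mulnCA -!mulnA.
  by rewrite leq_mul2l; apply/orP; right; move: st; clear; lia.
have h2 : 2 ^ t * m ^ s <= m.+1 ^ s.
  rewrite (divn_eq s m) -/t !expnD (mulnC t) !expnM mulnA -expnMn.
  apply: leq_mul; last by case: (s %% m) => // k; rewrite leq_exp2r // leqnSn.
  case: (t) ht => // t' _; rewrite leq_exp2r //.
  have := expn_succ_bound m m; rewrite addnn -mul2n -mulnA mulnCA leq_pmul2l //.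
apply: leq_trans h2; rewrite mulnC ltn_pmul2r ?expn_gt0 //.
apply: leq_ltn_trans (HN t (ltnW ht)); by rewrite leq_exp2r.
Qed.

Section Absorb.
Variables (V : finType) (G : sgraph V).
Implicit Types (W A B : {set V}).

Lemma tileable_seq (s : seq (V * V * V)) W :
  all (tri G) s -> uniq (flat s) -> flat s =i W -> tileable G W.
Proof.
move=> ts us sW; exists s => //; apply: uniq_perm => //; first exact: enum_uniq.
by move=> v; rewrite mem_enum sW.
Qed.

Lemma tileableE W : tileable G W ->
  exists s, [/\ all (tri G) s, uniq (flat s), flat s =i W & 3 * size s = #|W|].
Proof.
move=> [s ts ps]; exists s; split => //.
- by rewrite (perm_uniq ps) enum_uniq.
- by move=> v; rewrite (perm_mem ps) mem_enum.
- by rewrite -size_flat (perm_size ps) cardE.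
Qed.

Lemma tileableU A B : [disjoint A & B] -> tileable G A -> tileable G B ->
  tileable G (A :|: B).
Proof.
move=> dAB /tileableE[s [ts us sA _]] /tileableE[s' [ts' us' sB _]].
apply: (@tileable_seq (s ++ s')); rewrite ?all_cat ?flat_cat ?ts //.
  rewrite cat_uniq us us' andbT /=; apply/hasPn => v; rewrite sB /= sA => vB.
  by apply/negP => vA; move/pred0P: dAB => /(_ v); rewrite /= vA vB.
by move=> v; rewrite mem_cat sA sB inE.
Qed.

Definition cn W (xs : seq V) := [set w in W | all (fun x => G x w) xs].

Lemma card_cn W H xs : (forall v, v \in W -> (2 * H + 1) * #|W| <= 3 * H * dg G W v) ->
  all (mem W) xs ->
  3 * H * #|W| + size xs * #|W| <= 3 * H * #|cn W xs| + size xs * (H * #|W|).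
Proof.
move=> dW; elim: xs => [|x xs IH] /=.
  move=> _; rewrite !mul0n !addn0 leq_mul2l; apply/orP; right.
  by apply/subset_leq_card/subsetP => v vW; rewrite inE vW.
case/andP=> xW /IH {}IH; have := dW _ xW.
have : #|cn W xs| + dg G W x <= #|cn W (x :: xs)| + #|W|.
  rewrite /dg -cardsUI addnC leq_add //; apply/subset_leq_card/subsetP => v.
    by rewrite !inE /= => /andP[/andP[-> ->] /andP[_ ->]].
  by rewrite !inE => /orP[] /andP[].
move=> h1 h2; have : 3 * H * (#|cn W xs| + dg G W x) <= 3 * H * (#|cn W (x :: xs)| + #|W|).
  by rewrite leq_mul2l h1 orbT.
move: IH h2; clear; nia.
Qed.

(** Each vertex misses at most a fraction [1/3 - 1/(3H)] of [W], so three vertices exclude at most a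
    fraction [1 - 1/H]. *)
Lemma cn3 W H xs : 0 < H ->
  (forall v, v \in W -> (2 * H + 1) * #|W| <= 3 * H * dg G W v) ->
  all (mem W) xs -> size xs <= 3 -> #|W| <= H * #|cn W xs|.
Proof.
move=> H0 dW xsW sxs; have := card_cn dW xsW.
move: sxs H0; move: (size xs) => k; move: #|cn W xs| #|W|; clear => c w k3 H0 h.
have : w <= H * w by rewrite leq_pmull.
by case: k k3 h => [|[|[|[|]]]] // _ h hw; rewrite -mulnA in h; lia.
Qed.

(** Averaging over the pairs of a member of [Ls] and a vertex: if each member likes a fraction [1/b]
    of the vertices, some vertex is liked by a fraction [1/b] of the members. *)
Lemma pick_average (T : eqType) (Ls : seq T) (good : T -> V -> bool) W b :
  0 < #|W| -> (forall l, l \in Ls -> #|W| <= b * #|[set p in W | good l p]|) ->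
  exists2 p, p \in W & size Ls <= b * count (good^~ p) Ls.
Proof.
move=> W0 hL; have e : \sum_(p in W) count (good^~ p) Ls
    = \sum_(l <- Ls) #|[set p in W | good l p]|.
  have cE (Q : pred T) : count Q Ls = \sum_(l <- Ls) (Q l : nat).
    by elim: (Ls) => [|l r IH]; rewrite ?big_nil ?big_cons //= IH.
  under eq_bigr do rewrite cE; rewrite exchange_big /=; apply: eq_bigr => l _.
  rewrite -sum1_card [RHS](eq_bigl (fun p => (p \in W) && good l p)).
    by rewrite big_mkcondr /=; apply: eq_bigr => p _; case: (good l p).
  by move=> p; rewrite inE.
have h : size Ls * #|W| <= b * \sum_(l <- Ls) #|[set p in W | good l p]|.
  elim: Ls hL {e} => [|l r IH] hL; rewrite ?big_nil // big_cons mulnDr /= mulSn.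
  apply: leq_add; first by apply: hL; rewrite mem_head.
  by apply: IH => l' l'r; apply: hL; rewrite inE l'r orbT.
case: (pickP (fun p => (p \in W) && (size Ls <= b * count (good^~ p) Ls))) => [p|H].
  by case/andP; exists p.
exfalso; move: h; rewrite -e big_distrr /= leqNgt => /negP; apply.
rewrite mulnC -sum_nat_const; case/card_gt0P: W0 => p0 p0W.
rewrite (bigD1 p0) //= [X in _ < X](bigD1 p0) //= -addSn.
apply: leq_add; first by have := H p0; rewrite p0W leqNgt => /negbFE.
apply: leq_sum => p /andP[pW _]; have := H p; rewrite pW leqNgt => /negbFE; exact: ltnW.
Qed.
End Absorb.

Section Absorber.
Variables (V : finType) (G : sgraph V) (W : {set V}) (H : nat).
Hypotheses (H0 : 0 < H) (W0 : 0 < #|W|)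
  (dW : forall v, v \in W -> (2 * H + 1) * #|W| <= 3 * H * dg G W v).
Implicit Types (A B : {set V}).

Lemma cn_avoid A xs : all (mem W) xs -> size xs <= 3 -> 2 * H * #|A| <= #|W| ->
  #|W| <= 2 * H * #|[set p in W | (p \in cn G W xs) && (p \notin A)]|.
Proof.
move=> xsW sxs hA; set S := [set p in W | _]; have := cn3 H0 dW xsW sxs.
have : #|cn G W xs| <= #|S| + #|A|.
  apply: leq_trans (leq_card_setU _ _); apply/subset_leq_card/subsetP => v vc.
  have := vc; rewrite inE => /andP[vW _].
  by rewrite inE inE vW vc /= orNb.
move: hA; move: #|cn G W xs| #|A| #|W| #|S|; clear => c a w d hA hc hw.
have : H * c <= H * (d + a) by rewrite leq_mul2l hc orbT.
move: hw hA; rewrite mulnDr -!mulnA; clear; lia.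
Qed.

Lemma cn_pick A xs : all (mem W) xs -> size xs <= 3 -> 2 * H * #|A| < #|W| ->
  exists v, [/\ v \in W, all (G^~ v) xs & v \notin A].
Proof.
move=> xsW sxs hA; have := cn_avoid xsW sxs (ltnW hA).
case: (set_0Vmem [set p in W | (p \in cn G W xs) && (p \notin A)]) => [->|[v]].
  by rewrite cards0 muln0 leqNgt W0.
rewrite !inE => /and3P[vW /andP[_ vx] vA] _; by exists v.
Qed.

(** Two rounds of averaging, one for each end of the edge [ab]; each keeps a fraction [1/(2H)] of
    the list. *)
Lemma edge_pick (T : eqType) (Ls : seq T) (f : T -> V) u A : u \in W ->
  (forall l, l \in Ls -> f l \in W) -> 2 * H * #|A| <= #|W| -> 0 < size Ls ->
  exists a b, [/\ a \in W, b \in W, a \notin A, b \notin A & tri G (u, a, b)] /\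
    size Ls <= (2 * H) ^ 2 * count (fun l => tri G (f l, a, b)) Ls.
Proof.
move=> uW fW hA Ls0.
have [a aW ha] : exists2 a, a \in W & size Ls <= 2 * H * count
    (fun l => (a \in cn G W [:: f l; u]) && (a \notin A)) Ls.
  apply: (@pick_average _ _ _ (fun l a => (a \in cn G W [:: f l; u]) && (a \notin A))) => //.
  by move=> l lL; apply: cn_avoid; rewrite //= uW fW.
set Ls' := [seq l <- Ls | (a \in cn G W [:: f l; u]) && (a \notin A)].
have sL' : size Ls <= 2 * H * size Ls' by rewrite size_filter.
have [b bW hb] : exists2 b, b \in W & size Ls' <= 2 * H * count
    (fun l => (b \in cn G W [:: f l; u; a]) && (b \notin A)) Ls'.
  apply: (@pick_average _ _ _ (fun l b => (b \in cn G W [:: f l; u; a]) && (b \notin A))) => //.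
  move=> l; rewrite mem_filter => /andP[_ lL].
  by apply: cn_avoid; rewrite //= uW fW //= andbT.
have : size Ls <= (2 * H) ^ 2 * count
    (fun l => (b \in cn G W [:: f l; u; a]) && (b \notin A)) Ls'.
  by apply: leq_trans sL' _; rewrite -mulnn -[X in _ <= X]mulnA leq_mul2l hb orbT.
rewrite count_filter; set P := predI _ _ => hP.
have PE l : P l -> [/\ a \notin A, b \notin A, tri G (u, a, b) & tri G (f l, a, b)].
  rewrite /P /= /tri !inE /=.
  by case/andP=> /andP[/and5P[_ -> -> -> _] ->] /andP[/and4P[_ -> -> _] ->].
have /hasP[l lL /PE[aA bA uab _]] : has P Ls.
  by rewrite has_count; move: hP Ls0; case: (count P Ls) => //; rewrite muln0 leqn0; case: size.
exists a, b; split => //; apply: leq_trans hP _; rewrite leq_mul2l; apply/orP; right.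
by apply: sub_count => l' /PE[].
Qed.

(** The triple is arbitrary, not necessarily a triangle; the condition is vacuous for triples with
    repeated vertices, or with a vertex in [A] or outside [W]. *)
Definition absorbs A (l : V * V * V) := `[< uniq (flat [:: l]) ->
  all (mem (W :\: A)) (flat [:: l]) -> tileable G (A :|: [set v in flat [:: l]]) >].

(** The absorber consists of a triangle [uvw] and three edges [a_i b_i]. By itself it is tiled by
    [u a1 b1], [v a2 b2], [w a3 b3]; together with a triple [xyz] it is tiled by [x a1 b1],
    [y a2 b2], [z a3 b3] and [uvw]. Choosing each edge by averaging makes this work for a fraction
    [(2H)^-6] of the triples. *)
Lemma absorb_step A (Ls : seq (V * V * V)) : 2 * H * (#|A| + 9) <= #|W| ->
  A \subset W -> (forall l, l \in Ls -> all (mem W) (flat [:: l])) -> 0 < size Ls ->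
  exists B, [/\ B \subset W, [disjoint A & B], #|B| <= 9, tileable G B &
    size Ls <= (2 * H) ^ 6 * count (absorbs B) Ls].
Proof.
move=> hA AW LsW Ls0.
have cA (r : seq V) : size r <= 8 -> 2 * H * #|A :|: [set v in r]| < #|W|.
  move=> sr; apply: leq_trans hA; rewrite ltn_pmul2l ?muln_gt0 //.
  apply: leq_ltn_trans (leq_card_setU _ _) _; rewrite ltn_add2l cardsE.
  exact: leq_ltn_trans (card_size _) _.
have [u [uW _ uA]] := @cn_pick _ [::] isT isT (cA [::] isT).
have [v [vW /andP[uv _] vA]] := @cn_pick _ [:: u] (introT andP (conj uW isT)) isT (cA [:: u] isT).
have [w [wW /and3P[uw vw _] wA]] :=
  @cn_pick _ [:: u; v] (introT and3P (And3 uW vW isT)) isT (cA [:: u; v] isT).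
have fW (f : V * V * V -> V) (Ls' : seq (V * V * V)) : (forall l, f l \in flat [:: l]) -> {subset Ls' <= Ls} ->
    forall l, l \in Ls' -> f l \in W.
  by move=> hf sL l /sL /LsW /allP; apply.
have [a1 [b1 [[a1W b1W a1A b1A t1] h1]]] := edge_pick uW
  (fW (fun l => l.1.1) _ (fun l => mem_head _ _) (fun _ h => h)) (ltnW (cA [:: u; v; w] isT)) Ls0.
set L1 := [seq l <- Ls | tri G (l.1.1, a1, b1)].
have {}h1 : size Ls <= (2 * H) ^ 2 * size L1 by rewrite size_filter.
have sL1 : {subset L1 <= Ls} by move=> l; rewrite mem_filter => /andP[].
have L10 : 0 < size L1 by move: h1 Ls0; case: (size L1) => //; rewrite muln0 leqn0; case: size.
have m12 (l : V * V * V) : l.1.2 \in flat [:: l] by rewrite !inE eqxx orbT.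
have [a2 [b2 [[a2W b2W a2A b2A t2] h2]]] := edge_pick vW
  (fW (fun l => l.1.2) _ m12 sL1) (ltnW (cA [:: u; v; w; a1; b1] isT)) L10.
set L2 := [seq l <- L1 | tri G (l.1.2, a2, b2)].
have {}h2 : size L1 <= (2 * H) ^ 2 * size L2 by rewrite (size_filter _ L1).
have sL2 : {subset L2 <= Ls}.
  by move=> l hl; apply: sL1; move: hl; rewrite [l \in L2]mem_filter => /andP[].
have L20 : 0 < size L2 by move: h2 L10; case: (size L2) => //; rewrite muln0 leqn0; case: size.
have m2 (l : V * V * V) : l.2 \in flat [:: l] by rewrite !inE eqxx !orbT.
have [a3 [b3 [[a3W b3W a3A b3A t3] h3]]] := edge_pick wW
  (fW (fun l => l.2) _ m2 sL2) (ltnW (cA [:: u; v; w; a1; b1; a2; b2] isT)) L20.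
set L3 := [seq l <- L2 | tri G (l.2, a3, b3)].
have {}h3 : size L2 <= (2 * H) ^ 2 * size L3 by rewrite (size_filter _ L2).
pose sB := [:: (u, a1, b1); (v, a2, b2); (w, a3, b3)].
have ab (a b x : V) : tri G (x, a, b) -> [/\ x != a, x != b & a != b].
  by case/and3P => *; split; apply: sgN; eassumption.
have uB : uniq (flat sB).
  move: (ab _ _ _ t1) (ab _ _ _ t2) (ab _ _ _ t3) => [n1 n2 n3] [n4 n5 n6] [n7 n8 n9].
  move: (sgN uv) (sgN uw) (sgN vw) => n10 n11 n12.
  move: a1A b1A a2A b2A a3A b3A; rewrite /= !inE !negb_or.
  rewrite n1 n2 n3 n4 n5 n6 n7 n8 n9 n10 n11 n12 => *.
  repeat match goal with h : is_true (_ && _) |- _ => case/andP: h => * end.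
  by do ![apply/andP; split]; rewrite // eq_sym.
have tB : all (tri G) sB by rewrite /= t1 t2 t3.
have WB : all (mem W) (flat sB).
  by rewrite /flat /= uW a1W b1W vW a2W b2W wW a3W b3W.
have AB : all (fun x => x \notin A) (flat sB).
  move: uA vA wA a1A b1A a2A b2A a3A b3A; rewrite [all _ _]/= !inE !negb_or.
  by do 9!case/andP => -> _.
exists [set x in flat sB]; split.
- by apply/subsetP => x; rewrite inE => /(allP WB).
- apply/pred0P => x /=; apply/negbTE/negP => /andP[xA]; rewrite inE => /(allP AB).
  by rewrite xA.
- by rewrite cardsE (card_uniqP uB).
- by apply: (@tileable_seq _ _ sB) => // x; rewrite [RHS]in_set.
have hh : size Ls <= (2 * H) ^ 6 * size L3.
  rewrite (_ : 6 = 2 + (2 + 2)) // !expnD.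
  move: ((2 * H) ^ 2) (size L1) (size L2) h1 h2 h3 => K k1 k2 h1 h2 h3; rewrite -!mulnA.
  by apply: (leq_trans h1 (leq_mul (leqnn _) (leq_trans h2 (leq_mul (leqnn _) h3)))).
apply: leq_trans hh _; rewrite leq_mul2l; apply/orP; right.
rewrite /L3 /L2 /L1 size_filter !count_filter; apply: sub_count => -[[x y] z] /=.
case/andP=> /andP[xz xy] xx; apply/asboolP => ul ulW.
have p : perm_eq (flat [:: (x, a1, b1); (y, a2, b2); (z, a3, b3); (u, v, w)])
    (flat sB ++ flat [:: (x, y, z)]).
  apply/permP => P; rewrite /flat /=.
  move: (P x : nat) (P y : nat) (P z : nat) (P u : nat) (P v : nat) (P w : nat) (P a1 : nat)
    (P a2 : nat) (P a3 : nat) (P b1 : nat) (P b2 : nat) (P b3 : nat); clear; lia.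
apply: (@tileable_seq _ _ [:: (x, a1, b1); (y, a2, b2); (z, a3, b3); (u, v, w)]).
- by rewrite /= xx xy xz /tri /= uv uw vw.
- rewrite (perm_uniq p) cat_uniq uB ul andbT; apply/hasPn => t tl.
  have := allP ulW _ tl; rewrite /= !inE; by case/andP.
- by move=> t; rewrite (perm_mem p) mem_cat in_setU !in_set.
Qed.
End Absorber.

Section Tiling.

(* The minimum degree inside [W] is at least (2/3 + e/(3H)) |W|. *)
Definition dense (V : finType) (G : sgraph V) (W : {set V}) H e :=
  forall v, v \in W -> (2 * H + e) * #|W| <= 3 * H * dg G W v.

Definition unabsorbed (V : finType) (G : sgraph V) (W A : {set V}) :=
  [set l : V * V * V | ~~ absorbs G W A l].

(** Greedy iteration of [absorb_step] on the triples not yet absorbed: with [b = (2H)^6], each round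
    multiplies their number by at most [1 - 1/b]. *)
Lemma absorber_iter (V : finType) (G : sgraph V) (W : {set V}) H k :
  0 < H -> 0 < #|W| -> dense G W H 1 -> 2 * H * (9 * k) <= #|W| ->
  exists A : {set V}, [/\ A \subset W, #|A| <= 9 * k, tileable G A &
    #|unabsorbed G W A| * ((2 * H) ^ 6) ^ k <= ((2 * H) ^ 6).-1 ^ k * #|W| ^ 3].
Proof.
move=> H0 W0 dW; set b := (2 * H) ^ 6.
have b0 : 0 < b by rewrite expn_gt0 muln_gt0 H0.
elim: k => [|k IH] hk.
  exists set0; split; rewrite ?sub0set ?cards0 //.
    by apply: (@tileable_seq _ _ [::]) => // v; rewrite inE.
  rewrite !expn0 muln1 mul1n.
  have -> : #|W| ^ 3 = #|setX (setX W W) W| by rewrite !cardsX !expnS expn0 muln1 mulnA.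
  apply/subset_leq_card/subsetP => -[[x y] z]; rewrite in_set => /asboolPn h.
  apply/negPn/negP => nW; apply: h => _ /allP aW; exfalso; move/negP: nW; apply.
  have xW : x \in W :\: set0 by apply: aW; rewrite !inE eqxx.
  have yW : y \in W :\: set0 by apply: aW; rewrite !inE eqxx orbT.
  have zW : z \in W :\: set0 by apply: aW; rewrite !inE eqxx !orbT.
  by move: xW yW zW; rewrite setD0 !in_setX /= => -> -> ->.
have [|A [AW cA tA hA]] := IH.
  by apply: leq_trans hk; rewrite !leq_mul2l leqnSn !orbT.
case: (posnP #|unabsorbed G W A|) => [U0|U0].
  by exists A; split => //; [apply: leq_trans cA _; rewrite leq_mul2l leqnSn | rewrite U0].
have [||l||B [BW dAB cB tB hB]] := @absorb_step V G W H H0 W0 dW A (enum (unabsorbed G W A)) => //.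
- by apply: leq_trans hk; rewrite leq_mul2l mulnS addnC leq_add2l cA orbT.
- rewrite mem_enum inE; case: l => [[x y] z] /asboolPn h; apply/negPn/negP => n.
  apply: h => _ a; exfalso; move/negP: n; apply; apply/allP => v /(allP a).
  by rewrite /= !inE => /andP[].
- by rewrite -cardE.
exists (A :|: B); split.
- by rewrite subUset AW.
- by apply: leq_trans (leq_card_setU _ _) _; rewrite mulnS addnC; apply: leq_add.
- exact: tileableU.
have hU : #|unabsorbed G W (A :|: B)| + count (absorbs G W B) (enum (unabsorbed G W A))
    <= #|unabsorbed G W A|.
  rewrite -size_filter -(card_uniqP (filter_uniq _ (enum_uniq _))).
  set F := [seq _ <- _ | _]; have -> : #|F| = #|[set x in F]| by rewrite cardsE.
  rewrite -cardsUI (_ : _ :&: _ = set0) ?cards0 ?addn0.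
    apply/subset_leq_card/subsetP => l; rewrite in_setU => /orP[]; last first.
      by rewrite in_set mem_filter mem_enum => /andP[].
    rewrite !in_set; apply: contra => /asboolP h; apply/asboolP => ul al.
    have alA : all (mem (W :\: A)) (flat [:: l]).
      by apply: sub_all al => v /=; rewrite !inE negb_or => /andP[/andP[-> _] ->].
    rewrite setUAC; apply: tileableU => //; last exact: h.
    apply/pred0P => v /=; apply/negbTE/negP; rewrite in_setU in_set => /andP[/orP[vA|vl] vB].
      by move/pred0P: dAB => /(_ v); rewrite /= vA vB.
    by have := allP al _ vl; rewrite /= !inE vB orbT.
  apply/setP => l; rewrite in_setI [RHS]in_set0 ![_ \in [set _ | _]]in_set mem_filter.
  apply/negbTE/negP => /and3P[/negP n /asboolP h _]; apply: n; apply/asboolP => ul al.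
  have alB : all (mem (W :\: B)) (flat [:: l]).
    by apply: sub_all al => v /=; rewrite !inE negb_or => /andP[/andP[_ ->] ->].
  rewrite -setUA; apply: tileableU => //; last exact: h.
  apply/pred0P => v /=; apply/negbTE/negP; rewrite in_setU in_set => /andP[vA /orP[vB|vl]].
    by move/pred0P: dAB => /(_ v); rewrite /= vA vB.
  by have := allP al _ vl; rewrite /= !inE vA.
move: hB; rewrite -cardE => hB.
rewrite [b ^ k.+1]expnS [b.-1 ^ k.+1]expnS mulnA (mulnC _ b).
have h1 : b * #|unabsorbed G W (A :|: B)| <= b.-1 * #|unabsorbed G W A|.
  have := leq_mul (leqnn b) hU; move: hB b0; rewrite -/b mulnDr.
  move: #|unabsorbed G W A| #|unabsorbed G W (A :|: B)| (count _ _).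
  case: (b) => // b' c d e; clear; rewrite succnK mulSn; lia.
apply: leq_trans (_ : b.-1 * (#|unabsorbed G W A| * b ^ k) <= _); last first.
  by rewrite -mulnA leq_mul2l hA orbT.
by rewrite mulnA leq_mul2r h1 orbT.

Qed.

Lemma absorber_exists H : 0 < H -> exists N, forall (V : finType) (G : sgraph V) (W : {set V}),
  N <= #|W| -> dense G W H 1 -> exists A : {set V}, [/\ A \subset W, 3 * H * #|A| <= #|W|,
    tileable G A & forall l, absorbs G W A l].
Proof.
move=> H0; have b1 : 1 < (2 * H) ^ 6.
  by rewrite -(exp1n 6) ltn_exp2r //; move: H0; clear; lia.
have K0 : 0 < 27 * H by rewrite muln_gt0.
have [N HN] := exp_beats_cube b1 K0; exists N.+1 => V G W hN dW.
(* Since [27 = 3 * 9], the [9k] vertices make up at most [|W|/(3H)], yet [k] is linear in [|W|], so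
   fewer than one of the [|W|^3] triples remains unabsorbed. *)
have hk := leq_trunc_div #|W| (27 * H); set k := #|W| %/ (27 * H) in hk.
have [||A [AW cA tA hA]] := @absorber_iter V G W H k H0 _ dW.
- exact: leq_ltn_trans hN.
- by apply: leq_trans hk; clear; nia.
exists A; split=> //.
  apply: leq_trans hk; apply: leq_trans (_ : 3 * H * (9 * k) <= _); last by clear; nia.
  by rewrite leq_mul2l cA orbT.
move=> l; apply/negPn/negP => nl.
have : 0 < #|unabsorbed G W A| by apply/card_gt0P; exists l; rewrite inE.
move=> u0; have := leq_trans hA (ltnW (HN _ (ltnW hN))).
have := HN _ (ltnW hN); rewrite -/k => h2 _; move: (leq_ltn_trans hA h2).
by rewrite ltnNge leq_pmull.
Qed.

(** Set an absorber [A] aside, pack the rest, and let [A] absorb three leftover vertices. As [|A|]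
    is at most [|W|/(3H)], removing it costs one unit of [e]. By divisibility, more than [3i]
    leftover vertices include at least three. *)
Lemma leftover_step H e i : 0 < H -> 0 < e ->
  (exists N, forall (V : finType) (G : sgraph V) (W : {set V}), N <= #|W| -> 3 %| #|W| ->
    dense G W H e -> exists2 s, packing G s W & #|left W s| <= 3 * i.+1) ->
  exists N, forall (V : finType) (G : sgraph V) (W : {set V}), N <= #|W| -> 3 %| #|W| ->
    dense G W H e.+1 -> exists2 s, packing G s W & #|left W s| <= 3 * i.
Proof.
move=> H0 e0 [N1 h1]; have [N2 h2] := absorber_exists H0.
exists (2 * N1 + N2) => V G W hN d3 dW.
have [||A [AW cA tA abA]] := h2 V G W.
- by move: hN; clear; lia.
- move=> v vW; apply: leq_trans (dW v vW); rewrite leq_mul2r; apply/orP; right.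
  by clear; lia.
have [sA [tsA usA sAE sizA]] := tileableE tA.
have cWA : #|W :\: A| + #|A| = #|W|.
  by rewrite addnC -(cardsID A W) (setIidPr AW).
have [||v|s ps cs] := h1 V G (W :\: A).
- have : 3 * #|A| <= 3 * H * #|A| by rewrite leq_mul2r leq_pmulr ?orbT.
  by move: hN cWA cA; move: (3 * H * #|A|) => x; clear; lia.
- have dA3 : 3 %| #|A| by rewrite -sizA dvdn_mulr.
  by rewrite -(dvdn_addl _ dA3) cWA.
- rewrite inE => /andP[_ vW]; have := dW v vW.
  have : dg G W v <= dg G (W :\: A) v + #|A|.
    rewrite /dg; apply: leq_trans (leq_card_setU _ _); apply/subset_leq_card/subsetP => u.
    by rewrite !inE => /andP[-> ->]; rewrite !andbT orNb.
  move: cWA cA; move: (dg G W v) (dg G (W :\: A) v) #|A| #|W :\: A| #|W|; clear.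
  move=> d d' a w' w <- ha hd h.
  have : 3 * H * d <= 3 * H * (d' + a) by rewrite leq_mul2l hd orbT.
  by rewrite mulnDr; move: h ha; rewrite addnS mulSn !mulnDr; move: (3 * H * a) => x; clear; lia.
have cps := card_left ps.
have [ts us /allP sW] := and3P ps.
have build s' (B : {set V}) : all (tri G) s' -> uniq (flat s') -> flat s' =i B ->
    [disjoint B & [set x in flat s]] -> B \subset W -> packing G (s ++ s') W.
  move=> ts' us' s'B dB BW; rewrite /packing all_cat ts ts' flat_cat cat_uniq us us' /= andbT.
  rewrite [all _ (_ ++ _)]all_cat; apply/and3P; split.
  - apply/hasPn => v; rewrite s'B => vB; apply/negP => /= vs.
    by move/pred0P: dB => /(_ v); rewrite /= vB in_set vs.
  - by apply/allP => v /sW; rewrite /= inE => /andP[].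
  - by apply/allP => v; rewrite s'B => /(subsetP BW).
have dA : [disjoint A & [set x in flat s]].
  apply/pred0P => v /=; apply/negbTE/negP; rewrite in_set => /andP[vA /sW].
  by rewrite /= inE vA.
case: (leqP #|left (W :\: A) s| (3 * i)) => hl.
  exists (s ++ sA); first exact: build AW.
  have := card_left (build _ _ tsA usA sAE dA AW); rewrite size_cat.
  by move: sizA cps cWA hl; clear; lia.
set L := left (W :\: A) s in hl cs cps.
have [w3 E3] := dvdnP d3.
have L3 : 2 < size (enum L).
  by rewrite -cardE; move: hl cps cWA sizA E3; clear; lia.
have eL v : v \in enum L -> (v \in W) && (v \notin A) && (v \notin flat s).
  by rewrite mem_enum /L in_left inE => /andP[/andP[-> ->] ->].
case: (enum L) L3 (enum_uniq L) eL => [|x [|y [|z r]]] // _ uL eL.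
have pL : {in flat [:: (x, y, z)], forall v, (v \in W) && (v \notin A) && (v \notin flat s)}.
  by move=> v vl; apply: eL; move: vl; rewrite !inE => /or3P[] ->; rewrite ?orbT.
have ul : uniq (flat [:: (x, y, z)]).
  move: uL; rewrite -[[:: x, y, z & r]]/(flat [:: (x, y, z)] ++ r) cat_uniq.
  by case/and3P.
have := abA (x, y, z); rewrite /absorbs => /asboolP /(_ ul) [].
  by apply/allP => v /pL; rewrite /= inE => /andP[/andP[-> ->]].
move=> s0 ts0 ps0; have /tileableE[s' [ts' us' s'E siz']] :
  tileable G (A :|: [set v in flat [:: (x, y, z)]]) by exists s0.
have dB : [disjoint A :|: [set v in flat [:: (x, y, z)]] & [set v in flat s]].
  apply/pred0P => v /=; apply/negbTE/negP; rewrite in_setU !in_set.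
  case/andP=> /orP[vA /sW|/pL]; first by rewrite /= inE vA.
  by case/andP=> _ /negP.
have BW : A :|: [set v in flat [:: (x, y, z)]] \subset W.
  rewrite subUset AW; apply/subsetP => v; rewrite in_set => /pL.
  by case/andP=> /andP[].
have cB : #|A :|: [set v in flat [:: (x, y, z)]]| = #|A| + 3.
  rewrite cardsU (_ : _ :&: _ = set0) ?cards0 ?subn0.
    by rewrite cardsE (card_uniqP ul).
  apply/setP => v; rewrite in_setI in_set0 in_set; apply/negbTE/negP.
  by case/andP=> vA /pL; rewrite vA andbF.
have pk := build _ _ ts' us' s'E dB BW.
exists (s ++ s') => //; have := card_left pk; rewrite size_cat.
by move: siz' cps cWA cs; rewrite cB; clear; lia.
Qed.

(* Each absorption of one leftover triple costs one unit of the slack. *)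
Lemma tiling_exists h : 0 < h -> exists N, forall (V : finType) (G : sgraph V) (W : {set V}),
  N <= #|W| -> 3 %| #|W| -> dense G W h 1 -> tileable G W.
Proof.
(* The slack [1/(3h)] is written as [2J] units of [1/(3 * 2Jh)]. One half of them serves the
   near-perfect packing, which leaves at most [3 * 2h = 3J] vertices; the other half pays for [J]
   absorption steps. *)
move=> h0; have [J JE] : exists J, J = 2 * h by exists (2 * h).
have J0 : 0 < J by rewrite JE muln_gt0.
have H0 : 0 < 2 * J * h by rewrite !muln_gt0 J0.
have base : exists N, forall (V : finType) (G : sgraph V) (W : {set V}), N <= #|W| -> 3 %| #|W| ->
    dense G W (2 * J * h) J -> exists2 s, packing G s W & #|left W s| <= 3 * J.
  exists 1 => V G W W0 _ dW.
  suff [s ps cs] : exists2 s, packing G s W & #|left W s| <= 3 * (2 * h).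
    by exists s; rewrite // JE.
  apply: near_perfect_packing => //; first by rewrite -JE.
  move=> v vW; have := dW v vW.
  have -> : (2 * (2 * J * h) + J) * #|W| = J * ((2 * (2 * h) + 1) * #|W|).
    by clear; lia.
  have -> : 3 * (2 * J * h) * dg G W v = J * (3 * (2 * h) * dg G W v) by clear; lia.
  by rewrite leq_pmul2l.
have steps i : i <= J -> exists N, forall (V : finType) (G : sgraph V) (W : {set V}),
    N <= #|W| -> 3 %| #|W| ->
    dense G W (2 * J * h) (J + i) -> exists2 s, packing G s W & #|left W s| <= 3 * (J - i).
  elim: i => [|i IH] hi; first by rewrite addn0 subn0.
  have [N hN] := leftover_step (e := J + i) (i := J - i.+1) H0 (ltn_addr _ J0)
    (ltac:(rewrite subnSK //; exact: IH (ltnW hi))).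
  by exists N => V G W; rewrite addnS; exact: hN.
have [N hN] := steps J (leqnn _); exists N => V G W w0 d3 dW.
have [|s ps] := hN V G W w0 d3.
  move=> v vW; have := dW v vW; rewrite -(leq_pmul2l (m := 2 * J)) ?muln_gt0 //.
  have -> : (2 * (2 * J * h) + (J + J)) * #|W| = 2 * J * ((2 * h + 1) * #|W|) by clear; lia.
  by have -> : 3 * (2 * J * h) * dg G W v = 2 * J * (3 * h * dg G W v) by clear; lia.
rewrite subnn muln0 leqn0 cards_eq0 => /eqP L0.
have [ts us /allP sW] := and3P ps; apply: (tileable_seq ts us) => v.
apply/idP/idP => [/sW //|vW]; apply/negPn/negP => vs.
by have := in_set0 v; rewrite -L0 in_left vW vs.
Qed.
End Tiling.

(** * Additive edge labelings *)

Section Structure.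
Variables (V : finType) (G : sgraph V) (W : {set V}) (d : nat).
Hypothesis dW : forall v, v \in W -> d <= dg G W v.
Local Open Scope ring_scope.

(* [Phi] is three times a vertex weight whose sum over every triangle is the
   number of edges of the triangle in the class [lab]. *)
Definition tri_additive (lab : rel V) (Phi : V -> int) :=
  forall a b c, a \in W -> b \in W -> c \in W -> G a b -> G a c -> G b c ->
  3 * (lab a b + lab a c + lab b c)%N%:Z = Phi a + Phi b + Phi c.

Lemma common_nbr xs : all (mem W) xs -> (size xs * (#|W| - d) < #|W|)%N ->
  exists2 u, u \in W & all (G^~ u) xs.
Proof.
move=> xsW h.
have : (#|W| <= #|cn G W xs| + size xs * (#|W| - d))%N.
  elim: xs xsW {h} => [_|x xs IH] /=.
    by rewrite mul0n addn0; apply/subset_leq_card/subsetP => v vW; rewrite inE vW.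
  case/andP=> xW /IH {}IH; have := dW xW.
  have : (#|cn G W xs| + dg G W x <= #|cn G W (x :: xs)| + #|W|)%N.
    rewrite /dg -cardsUI addnC leq_add //; apply/subset_leq_card/subsetP => v.
      by rewrite !inE /= => /andP[/andP[-> ->] /andP[_ ->]].
    by rewrite !inE => /orP[] /andP[].
  have : (dg G W x <= #|W|)%N by apply/subset_leq_card/subsetP => v; rewrite inE => /andP[].
  by move: IH; rewrite mulSn; clear; lia.
move=> h2; have : (0 < #|cn G W xs|)%N by move: h h2; clear; lia.
by case/card_gt0P=> u; rewrite inE => /andP[uW uxs]; exists u.
Qed.

Lemma sum_indicator (P : pred V) :
  \sum_(v in W) (P v : nat)%:Z = #|[set v in W | P v]|%:Z.
Proof.
rewrite -(big_morph Posz PoszD (erefl 0)); congr Posz; rewrite -sum1_card.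
rewrite [RHS](eq_bigl (fun v => (v \in W) && P v)) => [|v]; last by rewrite inE.
by rewrite big_mkcondr; apply: eq_bigr => v _; case: (P v).
Qed.

Lemma sum_affine (F : V -> int) k m : \sum_(v in W) (k * F v + m) = k * (\sum_(v in W) F v) + m * #|W|%:Z.
Proof. by rewrite big_split /= -mulr_sumr sumr_const -mulr_natr natz. Qed.

Definition is_K4 a b c e := [&& [&& a \in W, b \in W, c \in W & e \in W],
  [&& G a b, G a c & G b c] & [&& G e a, G e b & G e c]].

Hypotheses (W0 : (0 < #|W|)%N) (d3 : (2 * #|W| < 3 * d)%N).

Lemma common3 xs : all (mem W) xs -> (size xs <= 3)%N ->
  exists2 u, u \in W & all (G^~ u) xs.
Proof.
move=> xsW sx; apply: common_nbr => //.
apply: leq_ltn_trans (_ : 3 * (#|W| - d) < _)%N; first by rewrite leq_mul2r sx orbT.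
by move: d3 W0; clear; lia.
Qed.

Lemma K4_exists : exists a b c e, is_K4 a b c e.
Proof.
have [a aW _] := @common3 [::] isT isT.
have [|b bW /andP[ab _]] := @common3 [:: a] _ isT; first by rewrite /= aW.
have [|c cW /and3P[ac bc _]] := @common3 [:: a; b] _ isT; first by rewrite /= aW bW.
have [|e eW /and4P[ae be ce _]] := @common3 [:: a; b; c] _ isT; first by rewrite /= aW bW cW.
by exists a, b, c, e; rewrite /is_K4 aW bW cW eW ab ac bc !(sgC _ e) ae be ce.
Qed.

Section Label.
Variables (lab : rel V) (Phi : V -> int).
Hypotheses (labC : symmetric lab) (add : tri_additive lab Phi).

(** Complete [a] and [v] to triangles over a common edge [xy]: the two triangles differ by at most
    two labeled edges, each worth 3. *)
Lemma Phi_low a v : a \in W -> v \in W -> Phi a - 6 <= Phi v.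
Proof.
move=> aW vW.
have [|x xW /and3P[ax vx _]] := @common3 [:: a; v] _ isT; first by rewrite /= aW vW.
have [|y yW /and4P[ay vy xy _]] := @common3 [:: a; v; x] _ isT; first by rewrite /= aW vW xW.
move: (add aW xW yW ax ay xy) (add vW xW yW vx vy xy); clear.
by case: (lab a x) (lab a y) (lab v x) (lab v y) => [] [] [] []; lia.
Qed.

Lemma K4_weights a b c e : is_K4 a b c e ->
  3 * (lab a b + lab a c + lab b c)%N%:Z = Phi a + Phi b + Phi c /\
  [/\ 3 * (lab e a + lab e b + lab a b)%N%:Z = Phi e + Phi a + Phi b,
    3 * (lab e a + lab e c + lab a c)%N%:Z = Phi e + Phi a + Phi c &
    3 * (lab e b + lab e c + lab b c)%N%:Z = Phi e + Phi b + Phi c].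
Proof.
case/and3P => /and4P[aW bW cW eW] /and3P[ab ac bc] /and3P[ea eb ec].
by split; [|split]; apply: add.
Qed.

(** The equations of a K_4 on [e], [a], [v] and a common neighbor force [v] to behave like [a], so
    the property spreads through the neighborhood of [e]. *)
Lemma cut_step e a v : e \in W -> a \in W -> v \in W -> G e a -> G e v -> G a v ->
  Phi e = -3 -> Phi a = 3 -> lab e a = false -> Phi v = 3 /\ lab e v = false.
Proof.
move=> eW aW vW ea ev av Pe Pa lea.
have [|u uW /and4P[eu au vu _]] := @common3 [:: e; a; v] _ isT.
  by rewrite /= eW aW vW.
move: (add eW aW vW ea ev av) (add eW aW uW ea eu au) (add aW vW uW av au vu)
  (add eW vW uW ev eu vu).
rewrite Pe Pa lea; clear; move: (Phi u) (Phi v) => fu fv.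
case: (lab e v) (lab e u) (lab a v) (lab a u) (lab v u) => [] [] [] [] []; lia.
Qed.

(** The K_4 equations give weight 3 to [a] and -3 to [e]. Two applications of [cut_step], through a
    common neighbor of [e], [a] and [v], give weight 3 to every neighbor [v] of [e]; by [Phi_low]
    the other weights are at least -3. *)
Lemma cut_sum a b c e : is_K4 a b c e -> lab a b -> lab a c -> lab b c ->
  ~~ lab e a -> ~~ lab e b -> ~~ lab e c ->
  3 * (2 * d%:Z - #|W|%:Z) <= \sum_(v in W) Phi v.
Proof.
move=> K lab_ac lac lbc /negbTE lea /negbTE leb /negbTE lec.
have [[Pa Pe] [aW eW ea]] : (Phi a = 3 /\ Phi e = -3) /\ [/\ a \in W, e \in W & G e a].
  split; last by case/and3P: K => /and4P[-> _ _ ->] _ /and3P[->].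
  have := K4_weights K; rewrite lab_ac lac lbc lea leb lec; clear => -[? [? ? ?]].
  by lia.
have step v : v \in W -> G e v -> Phi v = 3.
  move=> vW ev.
  have [|u uW /and4P[eu au vu _]] := @common3 [:: e; a; v] _ isT.
    by rewrite /= eW aW vW.
  have [Pu leu] := cut_step eW aW uW ea eu au Pe Pa lea.
  have uv : G u v by rewrite sgC.
  by have [] := cut_step eW uW vW eu ev uv Pe Pu leu.
apply: le_trans (_ : \sum_(v in W) (6 * (G e v : nat)%:Z - 3) <= _).
  rewrite sum_affine sum_indicator; have := dW eW; rewrite /dg /nbr.
  by move: #|[set w in W | G e w]| => x; clear; lia.
apply: ler_sum => v vW; case ev: (G e v); first by rewrite step.
by have := Phi_low aW vW; rewrite Pa; clear; lia.
Qed.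

Hypothesis noncut : forall a b c e, is_K4 a b c e -> lab a b -> lab a c -> lab b c ->
  [|| lab e a, lab e b | lab e c].

(** A negative weight would have to be -3, with [vp] and [vr] unlabeled. For a common neighbor [u]
    the equations then make [pru] a labeled triangle with no labeled edge to [v], against
    [noncut]. *)
Lemma Phi_two p r v : p \in W -> r \in W -> v \in W -> G p r -> G v p -> G v r ->
  lab p r -> Phi p = 3 -> Phi r = 3 -> 0 <= Phi v.
Proof.
move=> pW rW vW pr vp vr lpr Pp Pr.
have [|u uW /and4P[vu pu ru _]] := @common3 [:: v; p; r] _ isT.
  by rewrite /= vW pW rW.
have K : is_K4 p r u v by rewrite /is_K4 pW rW uW vW pr pu ru vp vr vu.
have := K4_weights K; rewrite Pp Pr lpr; have := noncut K lpr.
clear; move: (Phi u) (Phi v) => fu fv.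
case: (lab v p) (lab v r) (lab v u) (lab p u) (lab r u) => [] [] [] [] [] n [? [? ? ?]];
  try lia; by have := n isT isT.
Qed.

(** The three faces at [v] force the edges from [v] to be all labeled or all unlabeled; the latter
    means weight -3, which [Phi_two] excludes. *)
Lemma Phi_three p r t v : p \in W -> r \in W -> t \in W -> v \in W ->
  G p r -> G p t -> G r t -> G v p -> G v r -> G v t ->
  lab p r -> lab p t -> lab r t -> Phi p = 3 -> Phi r = 3 -> Phi t = 3 ->
  [/\ Phi v = 3, lab v p, lab v r & lab v t].
Proof.
move=> pW rW tW vW pr pt rt vp vr vt lpr lpt lrt Pp Pr Pt.
have h0 := Phi_two pW rW vW pr vp vr lpr Pp Pr.
have K : is_K4 p r t v by rewrite /is_K4 pW rW tW vW pr pt rt vp vr vt.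
have := K4_weights K; move: h0; rewrite Pp Pr Pt lpr lpt lrt.
clear; move: (Phi v) => fv.
by case: (lab v p) (lab v r) (lab v t) => [] [] [] h [? [? ? ?]]; split=> //; lia.
Qed.

Section Quad.
Variables a b c e : V.
Hypotheses (K : is_K4 a b c e) (lK : [&& [&& lab a b, lab a c & lab b c] &
  [&& lab e a, lab e b & lab e c]]).

Lemma Phi_quad : [/\ Phi a = 3, Phi b = 3, Phi c = 3 & Phi e = 3].
Proof.
have := K4_weights K; case/andP: lK => /and3P[-> -> ->] /and3P[-> -> ->]; clear.
by case=> ? [? ? ?]; split; lia.
Qed.

Definition deg_quad v := (G v a + G v b + G v c + G v e)%N.

Lemma Phi_deg_quad v : v \in W ->
  [/\ -3 <= Phi v, deg_quad v = 2%N -> 0 <= Phi v & (2 < deg_quad v)%N -> Phi v = 3].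
Proof.
move=> vW; have [Pa Pb Pc Pe] := Phi_quad.
have /and3P[/and4P[aW bW cW eW] /and3P[ab ac bc] /and3P[ea eb ec]] := K.
have /andP[/and3P[lab_ac lac lbc] /and3P[lea leb lec]] := lK.
split; first by have := Phi_low aW vW; rewrite Pa.
- rewrite /deg_quad; case va: (G v a); case vb: (G v b); case vc: (G v c);
  case ve: (G v e) => // _.
  + exact: (@Phi_two a b).
  + exact: (@Phi_two a c).
  + exact: (@Phi_two e a).
  + exact: (@Phi_two b c).
  + exact: (@Phi_two e b).
  + exact: (@Phi_two e c).
rewrite /deg_quad; case va: (G v a); case vb: (G v b); case vc: (G v c);
case ve: (G v e) => // _.
- by have [] := @Phi_three a b c v.
- by have [] := @Phi_three a b c v.
- by have [] := @Phi_three e a b v.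
- by have [] := @Phi_three e a c v.
- by have [] := @Phi_three e b c v.
Qed.

Lemma sum_deg_quad : (4 * d)%:Z <= \sum_(v in W) (deg_quad v)%:Z.
Proof.
have /and3P[/and4P[aW bW cW eW] _ _] := K.
rewrite /deg_quad; under eq_bigr do rewrite !PoszD.
rewrite !big_split /= !sum_indicator.
have E x : #|[set v in W | G v x]| = dg G W x.
  by rewrite /dg; apply: eq_card => v; rewrite !inE sgC.
rewrite !E; have := dW aW; have := dW bW; have := dW cW; have := dW eW.
by move: (dg G W a) (dg G W b) (dg G W c) (dg G W e); clear; lia.
Qed.

(** For [k] at most 3 neighbors in the quadruple, the weight is at least [3k - 6], and the numbers
    [k] add up to at least [4d]. *)
Lemma quad_sum_noK5 : (forall v, v \in W -> (deg_quad v < 4)%N) ->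
  6 * (2 * d%:Z - #|W|%:Z) <= \sum_(v in W) Phi v.
Proof.
move=> no5; apply: le_trans (_ : \sum_(v in W) (3 * (deg_quad v)%:Z - 6) <= _).
  rewrite sum_affine; have := sum_deg_quad; move: (\sum_(v in W) _) #|W|; clear; lia.
apply: ler_sum => v vW; have := Phi_deg_quad vW; have := no5 v vW.
move: (Phi v) (deg_quad v) => f; clear; case=> [|[|[|[|]]]] //= _ [h h2 h3];
  by [lia | have := h2 (erefl _); lia | have := h3 isT; lia].
Qed.

(** With [k = 4] allowed, the linear minorant of the bounds -3, -3, 0, 3, 3 for [k = 0, ..., 4] is
    changed to [2k - 5]. *)
Lemma quad_sum : 8 * d%:Z - 5 * #|W|%:Z <= \sum_(v in W) Phi v.
Proof.
apply: le_trans (_ : \sum_(v in W) (2 * (deg_quad v)%:Z - 5) <= _).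
  rewrite sum_affine; have := sum_deg_quad; move: (\sum_(v in W) _) #|W|; clear; lia.
apply: ler_sum => v vW; have := Phi_deg_quad vW.
have : (deg_quad v < 5)%N by rewrite /deg_quad; do 4!case: (G v _).
move: (Phi v) (deg_quad v) => f; clear; case=> [|[|[|[|[|]]]]] //= _ [h h2 h3];
  by [lia | have := h2 (erefl _); lia | have := h3 isT; lia].
Qed.

(** Now any four vertices have a common neighbor. Starting from [abc], the labeled triangles [abx],
    [axy], [xyz] replace its vertices one by one by neighbors of [v]; [Phi_three] applies at each
    step and finally to [v]. *)
Lemma quad_dense : (3 * #|W| < 4 * d)%N -> forall v, v \in W -> Phi v = 3.
Proof.
move=> d4 v vW; have [Pa Pb Pc Pe] := Phi_quad.
have common4 xs : all (mem W) xs -> size xs = 4 -> exists2 u, u \in W & all (G^~ u) xs.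
  by move=> xsW sx; apply: common_nbr => //; rewrite sx; move: d4 W0; clear; lia.
have /and3P[/and4P[aW bW cW eW] /and3P[ab ac bc] /and3P[ea eb ec]] := K.
have /andP[/and3P[lab_ac lac lbc] /and3P[lea leb lec]] := lK.
have [|x xW /and5P[ax bx cx vx _]] := common4 [:: a; b; c; v] _ (erefl _).
  by rewrite /= aW bW cW vW.
have [Px lxa lxb _] : [/\ Phi x = 3, lab x a, lab x b & lab x c].
  by apply: Phi_three; rewrite // sgC.
have [|y yW /and5P[ay by_ xy vy _]] := common4 [:: a; b; x; v] _ (erefl _).
  by rewrite /= aW bW xW vW.
have [Py lya _ lyx] : [/\ Phi y = 3, lab y a, lab y b & lab y x].
  by apply: Phi_three; rewrite // 1?sgC // labC.
have [|z zW /and5P[az xz yz vz _]] := common4 [:: a; x; y; v] _ (erefl _).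
  by rewrite /= aW xW yW vW.
have [Pz _ lzx lzy] : [/\ Phi z = 3, lab z a, lab z x & lab z y].
  by apply: Phi_three; rewrite // 1?sgC // labC.
have [] : [/\ Phi v = 3, lab v x, lab v y & lab v z]; last by [].
by apply: Phi_three; rewrite // labC.
Qed.
End Quad.
End Label.
End Structure.

(** * From vertex weights to a frequent color *)

Section Colors.
Variables (V : finType) (G : sgraph V) (W : {set V}) (d q : nat).
Hypotheses (dW : forall v, v \in W -> (d <= dg G W v)%N)
  (W0 : (0 < #|W|)%N) (d3 : (2 * #|W| < 3 * d)%N).
Variables (f : {set V} -> 'I_q) (Phi : 'I_q -> V -> int).
Hypothesis add : forall c, tri_additive G W (fun x y => f [set x; y] == c) (Phi c).
Local Open Scope ring_scope.
Local Notation K4 := (is_K4 G W).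

Definition col x y := f [set x; y].
Definition in_colors (S : {set 'I_q}) x y := col x y \in S.

Lemma colC x y : col x y = col y x.
Proof. by rewrite /col setUC. Qed.

Lemma in_colorsC S : symmetric (in_colors S).
Proof. by move=> x y; rewrite /in_colors colC. Qed.

Lemma additive_colors (S : {set 'I_q}) :
  tri_additive G W (in_colors S) (fun v => \sum_(c in S) Phi c v).
Proof.
move=> x y z xW yW zW xy xz yz; rewrite -!big_split /=.
have E e : ((e \in S : nat)%:Z = \sum_(c in S) (e == c : nat)%:Z).
  case eS: (e \in S); last first.
    by rewrite big1 // => c cS; case: eqP => // ec; rewrite ec cS in eS.
  rewrite (bigD1 e) //= eqxx big1 ?addr0 // => c /andP[_ ce].
  by rewrite eq_sym (negbTE ce).
rewrite !PoszD !E -!big_split /= mulr_sumr; apply: eq_bigr => c _.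
by rewrite -(add c xW yW zW xy xz yz) !PoszD.
Qed.

(** Pigeonhole over the colors in [S]; since [X] is positive, having fewer than [m] colors only
    helps. *)
Lemma exists_color (S : {set 'I_q}) (X : int) m : 0 < X -> (0 < m)%N -> (#|S| <= m)%N ->
  m%:Z * X <= \sum_(v in W) \sum_(c in S) Phi c v ->
  exists c, X <= \sum_(v in W) Phi c v.
Proof.
move=> X0 m0 Sm h; case: (pickP (fun c => X <= \sum_(v in W) Phi c v)) => [c hc|no].
  by exists c.
exfalso; move: h; rewrite exchange_big /= => h.
have h2 : \sum_(c in S) \sum_(v in W) Phi c v <= \sum_(c in S) (X - 1).
  apply: ler_sum => c _; have := no c; move: (\sum_(v in W) _) => s; clear; lia.
move: (le_trans h h2); rewrite sumr_const -mulr_natr natz; move: #|S| Sm X0 m0; clear => k km X0 m0 h.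
have : 0 <= (X - 1) * (m%:Z - k%:Z) by apply: mulr_ge0; move: km X0; clear; lia.
by rewrite mulrBr mulrBl mul1r; move: h m0; rewrite mulrBl mul1r; clear; lia.
Qed.

Definition is_cut a b c e (S := [set col a b; col a c; col b c]) :=
  [&& ~~ in_colors S e a, ~~ in_colors S e b & ~~ in_colors S e c].

Lemma cut_colors_sum a b c e (S := [set col a b; col a c; col b c]) :
  K4 a b c e -> is_cut a b c e ->
  3 * (2 * d%:Z - #|W|%:Z) <= \sum_(v in W) \sum_(k in S) Phi k v.
Proof.
move=> K /and3P[ea eb ec].
apply: (cut_sum dW W0 d3 (additive_colors S) K) => //;
  by rewrite /in_colors !inE eqxx ?orbT.
Qed.

Lemma gap_gt0 : 0 < 2 * d%:Z - #|W|%:Z.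
Proof. by move: W0 d3; clear; lia. Qed.

Lemma cut_color a b c e : K4 a b c e -> is_cut a b c e ->
  exists k, 2 * d%:Z - #|W|%:Z <= \sum_(v in W) Phi k v.
Proof.
move=> K C; apply: (@exists_color _ _ 3 gap_gt0 isT _ (cut_colors_sum K C)).
apply: leq_trans (leq_card_setU _ _) _; rewrite cards1 cards2.
by case: (_ != _).
Qed.

Lemma noncut_label (S : {set 'I_q}) : (forall a b c e, K4 a b c e -> ~~ is_cut a b c e) ->
  forall a b c e, K4 a b c e -> in_colors S a b -> in_colors S a c -> in_colors S b c ->
  [|| in_colors S e a, in_colors S e b | in_colors S e c].
Proof.
move=> nc a b c e K ab ac bc; have := nc _ _ _ _ K; rewrite /is_cut !negb_and !negbK.
have sub x y : in_colors [set col a b; col a c; col b c] x y -> in_colors S x y.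
  by rewrite /in_colors !inE -orbA => /or3P[] /eqP ->.
by case/or3P => /sub ->; rewrite ?orbT.
Qed.

(** Let [D_v] be the change of the indicator of color [k] at [v] in [{p, r, t}] when [x] is replaced
    by [y]. Each of the three pairs has the same sum, one third of the weight difference of [x] and
    [y]; so all three [D_v] are equal. *)
Lemma col_swap p r t x y : p \in W -> r \in W -> t \in W -> x \in W -> y \in W ->
  G p r -> G p t -> G r t -> G p x -> G r x -> G t x -> G p y -> G r y -> G t y ->
  forall k, (col p x == k : nat)%:Z - (col p y == k : nat)%:Z =
    (col r x == k : nat)%:Z - (col r y == k : nat)%:Z.
Proof.
move=> pW rW tW xW yW pr pt rt px rx tx py ry ty k.
move: (add k pW rW xW pr px rx) (add k pW rW yW pr py ry) (add k pW tW xW pt px tx)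
  (add k pW tW yW pt py ty) (add k rW tW xW rt rx tx) (add k rW tW yW rt ry ty).
rewrite -!/(col _ _) !PoszD; clear; lia.
Qed.

Definition K5 a b c x y := [&& K4 a b c x, y \in W & [&& G a y, G b y, G c y & G x y]].

Definition mono_cut a b c e := [&& K4 a b c e, col a b == col a c, col a b == col b c
  & is_cut a b c e].

Lemma K5_col a b c x y : K5 a b c x y -> col a x = col a y ->
  col b x = col b y /\ col c x = col c y.
Proof.
case/and3P=> /and3P[/and4P[aW bW cW xW] /and3P[ab ac bc] /and3P[xa xb xc]] yW
  /and4P[ay by_ cy xy] e.
have ax : G a x by rewrite sgC.
have bx : G b x by rewrite sgC.
have cx : G c x by rewrite sgC.
have cb : G c b by rewrite sgC.
split.
- have := @col_swap a b c x y aW bW cW xW yW ab ac bc ax bx cx ay by_ cy (col b x).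
  by rewrite e subrr eqxx; case: eqP => [->|].
- have := @col_swap a c b x y aW cW bW xW yW ac ab cb ax cx bx ay cy by_ (col c x).
  by rewrite e subrr eqxx; case: eqP => [->|].
Qed.

(** By [col_swap], [x] sees [a], [b], [c] in one color and [y] sees them in another. With the roles
    of [xy] and [abc] exchanged, [K5_col] makes [abc] monochromatic, and at least one of [x], [y]
    avoids its color. *)
Lemma K5_col_neq a b c x y : K5 a b c x y -> col a x != col a y ->
  exists a b c e, mono_cut a b c e.
Proof.
move=> K e; have := K.
case/and3P=> /and3P[/and4P[aW bW cW xW] /and3P[ab ac bc] /and3P[xa xb xc]] yW
  /and4P[ay by_ cy xy].
have ax : G a x by rewrite sgC.
have bx : G b x by rewrite sgC.
have cx : G c x by rewrite sgC.
have cb : G c b by rewrite sgC.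
have neq z w : [\/ z = x /\ w = y | z = y /\ w = x] ->
    [/\ col b z = col a z & col c z = col a z].
  move=> zw; have {zw} [zW wW [az bz cz] [aw bw cw] ne] : [/\ z \in W, w \in W,
      [/\ G a z, G b z & G c z], [/\ G a w, G b w & G c w] & col a z != col a w].
    by case: zw => -[-> ->]; split=> //; rewrite eq_sym.
  split; apply/eqP.
  - have := @col_swap a b c z w aW bW cW zW wW ab ac bc az bz cz aw bw cw (col a z).
    by rewrite eqxx [col a w == _]eq_sym (negbTE ne); case: (_ == _) => //; case: (_ == _).
  - have := @col_swap a c b z w aW cW bW zW wW ac ab cb az cz bz aw cw bw (col a z).
    by rewrite eqxx [col a w == _]eq_sym (negbTE ne); case: (_ == _) => //; case: (_ == _).
have [bxE cxE] := neq x y (or_introl (conj erefl erefl)).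
have [byE cyE] := neq y x (or_intror (conj erefl erefl)).
have yx : G y x by rewrite sgC.
have ca : G c a by rewrite sgC.
have ba : G b a by rewrite sgC.
have e1 : col c a = col c b.
  have K' : K5 x y c a b.
    by rewrite /K5 /is_K4; do ![apply/andP; split] => //; rewrite sgC.
  by have [] := K5_col K'; rewrite // ![col x _]colC bxE.
have e2 : col a b = col a c.
  have K' : K5 x y a b c.
    by rewrite /K5 /is_K4; do ![apply/andP; split] => //; rewrite sgC.
  by have [] := K5_col K'; rewrite // ![col x _]colC bxE.
have mono z : z \in W -> G a z -> G b z -> G c z -> col b z = col a z -> col c z = col a z ->
    col a z != col a b -> mono_cut a b c z.
  move=> zW az bz cz ebz ecz ne; rewrite /mono_cut /is_cut.
  have -> : K4 a b c z by rewrite /is_K4 aW bW cW zW ab ac bc ![G z _]sgC az bz cz.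
  rewrite e2 [col b c]colC -e1 [col c a]colC !eqxx /=.
  by rewrite /in_colors !inE ![col z _]colC ebz ecz !orbb -e2 ne.
case: (eqVneq (col a x) (col a b)) => [h|h]; last by exists a, b, c, x; exact: mono.
by exists a, b, c, y; apply: mono => //; rewrite -h eq_sym.
Qed.

(** Two edges of a K_5 that share a vertex and differ in color give a monochromatic cut by
    [K5_col_neq]; otherwise equality of colors spreads over the K_4 [abcx]. *)
Lemma K5_mono a b c x y : K5 a b c x y -> (exists a b c e, mono_cut a b c e) \/
  forall S, S = [set col a b] ->
  [&& [&& in_colors S a b, in_colors S a c & in_colors S b c] &
      [&& in_colors S x a, in_colors S x b & in_colors S x c]].
Proof.
move=> K; have := K.
case/and3P=> /and3P[/and4P[aW bW cW xW] /and3P[ab ac bc] /and3P[xa xb xc]] yW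
  /and4P[ay by_ cy xy].
case: (eqVneq (col x a) (col x b)) => [e1|ne]; last first.
  left; apply: (@K5_col_neq x y c a b) ne.
  by rewrite /K5 /is_K4; do ![apply/andP; split] => //; rewrite sgC.
case: (eqVneq (col x b) (col x c)) => [e2|ne]; last first.
  left; apply: (@K5_col_neq x y a b c) ne.
  by rewrite /K5 /is_K4; do ![apply/andP; split] => //; rewrite sgC.
case: (eqVneq (col a x) (col a b)) => [e3|ne]; last first.
  left; apply: (@K5_col_neq a c y x b) ne.
  by rewrite /K5 /is_K4; do ![apply/andP; split] => //; rewrite sgC.
right=> S ->; rewrite /in_colors !inE.
have K' : K5 x y a b c.
  by rewrite /K5 /is_K4; do ![apply/andP; split] => //; rewrite sgC.
have [_ e4] := K5_col K' e2.
have K'' : K5 x y c a b.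
  by rewrite /K5 /is_K4; do ![apply/andP; split] => //; rewrite sgC.
have [_ e5] := K5_col K'' e1.
by rewrite -e2 -e1 [col x a]colC e3 -e4 [col b c]colC -e5 [col c a]colC -e4 !eqxx.
Qed.

Lemma mono_cut_sum a b c e : mono_cut a b c e ->
  exists k, 3 * (2 * d%:Z - #|W|%:Z) <= \sum_(v in W) Phi k v.
Proof.
case/and4P => K /eqP e1 /eqP e2 C; exists (col a b).
have := cut_colors_sum K C; rewrite -e1 -e2 !setUid.
by under eq_bigr do rewrite big_set1.
Qed.

(** In a tiling this means [(2d - |W|)/3] edges, as weights are tripled. A cut involves at most 3
    colors with sum [3(2d - |W|)]; a K_4 in the absence of cuts and of a K_5 involves at most 6
    colors with sum [6(2d - |W|)]; a K_5 involves one color with sum [8d - 5|W|], enough because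
    [2|W| < 3d]. *)
Theorem color_bound : exists k, 2 * d%:Z - #|W|%:Z <= \sum_(v in W) Phi k v.
Proof.
case: (pickP (fun t : V * V * (V * V) => K4 t.1.1 t.1.2 t.2.1 t.2.2 &&
    is_cut t.1.1 t.1.2 t.2.1 t.2.2)) => [t /andP[K C]|nc0]; first exact: cut_color K C.
have nc a b c e : K4 a b c e -> ~~ is_cut a b c e.
  by move=> K; have := nc0 (a, b, (c, e)); rewrite /= K => /= ->.
have nmc a b c e : ~ mono_cut a b c e.
  by case/and4P=> K _ _; apply/negP/nc.
have [a [b [c [e K]]]] := K4_exists dW W0 d3.
have gap := gap_gt0.
pose S := [set col a b; col a c] :|: [set col b c; col e a] :|: [set col e b; col e c].
have lK : [&& [&& in_colors S a b, in_colors S a c & in_colors S b c] &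
    [&& in_colors S e a, in_colors S e b & in_colors S e c]].
  by rewrite /in_colors !inE !eqxx !orbT.
case: (pickP (fun t : V * V * (V * V) * V => K5 t.1.1.1 t.1.1.2 t.1.2.1 t.1.2.2 t.2)) => [t K'|n5].
  case: (K5_mono K') => [[? [? [? [? /nmc]]]]//|/(_ _ erefl)].
  set S1 := [set _] => l1; have /and3P[K1 _ _] := K'.
  have := quad_sum dW W0 d3 (additive_colors S1) (noncut_label (S := S1) nc) K1 l1.
  under eq_bigr do rewrite big_set1.
  move=> h; exists (col t.1.1.1 t.1.1.2); apply: le_trans h.
  by move: d3; clear; lia.
have := quad_sum_noK5 dW W0 d3 (additive_colors S) (noncut_label (S := S) nc) K lK.
move=> h; apply: (@exists_color S _ 6) => //; last apply: h.
- apply: leq_trans (leq_card_setU _ _) _; apply: (@leq_add _ _ 4 2).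
    apply: leq_trans (leq_card_setU _ _) _; apply: (@leq_add _ _ 2 2).
      by rewrite cards2; case: (_ != _).
    by rewrite cards2; case: (_ != _).
  by rewrite cards2; case: (_ != _).
move=> v vW; have := n5 (a, b, (c, e), v); rewrite /K5 /= K vW /= /deg_quad.
rewrite ![G v _]sgC; case: (G a v) (G b v) (G c v) (G e v) => [] [] [] [] //.
Qed.

(** A K_5 exists, so a single color suffices: either a monochromatic cut has only one color to share
    its sum, or [quad_dense] gives all vertices weight 3. *)
Theorem color_bound_dense : (3 * #|W| < 4 * d)%N ->
  exists k, 3 * (2 * d%:Z - #|W|%:Z) <= \sum_(v in W) Phi k v.
Proof.
move=> d4; have [a [b [c [e K]]]] := K4_exists dW W0 d3.
have /and3P[/and4P[aW bW cW eW] _ _] := K.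
have [||y yW] := @common_nbr _ G W d dW [:: a; b; c; e].
- by rewrite /= aW bW cW eW.
- by rewrite /=; move: d4 W0; clear; lia.
rewrite /= andbT => /and4P[ay by_ cy ey].
have K' : K5 a b c e y by rewrite /K5 K yW ay by_ cy ey.
case: (K5_mono K') => [[? [? [? [? /mono_cut_sum]]]]//|/(_ _ erefl)].
set S := [set _] => l1.
case: (pickP (fun t : V * V * (V * V) => mono_cut t.1.1 t.1.2 t.2.1 t.2.2)) => [t|nc0].
  exact: mono_cut_sum.
have nc x z t u : K4 x z t u -> in_colors S x z -> in_colors S x t -> in_colors S z t ->
    [|| in_colors S u x, in_colors S u z | in_colors S u t].
  move=> Kx; rewrite /in_colors !inE => /eqP e1 /eqP e2 /eqP e3.
  have := nc0 (x, z, (t, u)); rewrite /mono_cut /= Kx e1 e2 e3 !eqxx /is_cut /in_colors /=.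
  by rewrite e1 e2 e3 !inE !orbb; do 3!case: (_ == _).
have all3 := quad_dense dW W0 d3 (@in_colorsC S) (additive_colors S) nc K l1 d4.
exists (col a b); rewrite (eq_bigr (fun=> 3)).
  rewrite sumr_const -mulr_natr natz.
  have : (d <= #|W|)%N.
    by apply: leq_trans (dW aW) _; apply/subset_leq_card/subsetP => v; rewrite inE => /andP[].
  by clear; lia.
by move=> v vW; have := all3 v vW; rewrite big_set1.
Qed.
End Colors.

(** * Rigidity and gadgets *)

Section Counting.
Variables (V : finType) (q : nat) (f : {set V} -> 'I_q).

Definition wc c (t : V * V * V) : nat :=
  (col f t.1.1 t.1.2 == c) + (col f t.1.1 t.2 == c) + (col f t.1.2 t.2 == c).
Definition cnt c (s : seq (V * V * V)) := \sum_(t <- s) wc c t.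

Lemma cnt_cat c s1 s2 : cnt c (s1 ++ s2) = cnt c s1 + cnt c s2.
Proof. by rewrite /cnt big_cat. Qed.

Lemma sum_cnt s : \sum_(c < q) cnt c s = 3 * size s.
Proof.
rewrite /cnt exchange_big /=; elim: s => [|t s IH]; first by rewrite big_nil.
rewrite big_cons IH /= mulnS; congr (_ + _); rewrite /wc !big_split /=.
have E (x : 'I_q) : \sum_(c < q) (x == c) = 1.
  rewrite (bigD1 x) //= eqxx big1 // => c; rewrite eq_sym; by case: (x == c).
by rewrite !E.
Qed.
End Counting.

Section Rigid.
Variables (V : finType) (G : sgraph V) (q : nat) (f : {set V} -> 'I_q) (W : {set V}).

(** Four triangles are the largest exchange used below, in [gain_triangles]; this is the source of
    the 12 vertices of a gadget. *)
Definition rigid := forall s1 s2, all (tri G) s1 -> all (tri G) s2 ->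
  all (mem W) (flat s1) -> uniq (flat s1) -> perm_eq (flat s1) (flat s2) ->
  size s1 <= 4 -> forall c, cnt f c s1 = cnt f c s2.

Hypothesis rigidW : rigid.
Hypothesis rich : forall (A xs : seq V), all (mem W) xs -> size xs <= 3 -> size A <= 16 ->
  exists u, [/\ u \in W, all (G^~ u) xs & u \notin A].
Variable c : 'I_q.
Let w x y z : int := (wc f c (x, y, z))%:Z.
Local Open Scope ring_scope.

Lemma edge_in_common x y A : x \in W -> y \in W -> uniq A -> (size A <= 14)%N ->
  exists a b, [/\ tri G (x, a, b), tri G (y, a, b), a \in W, b \in W & uniq [:: a, b & A]].
Proof.
move=> xW yW uA sA.
have [||u [uW /and3P[xu yu _] uA']] := @rich A [:: x; y] _ isT; rewrite /= ?xW ?yW //.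
  exact: leq_trans sA _.
have [||v [vW /and4P[xv yv uv _] vA]] := @rich A [:: x; y; u] _ isT; rewrite /= ?xW ?yW ?uW //.
  exact: leq_trans sA _.
exists u, v; rewrite /tri /= xu xv uv yu yv; split=> //.
by rewrite inE (negbTE (sgN uv)) uA' vA uA.
Qed.

Lemma retile s1 s2 l : all (tri G) s1 -> all (tri G) s2 -> uniq l -> all (mem W) l ->
  (size s1 <= 4)%N -> perm_eq (flat s1) l -> perm_eq (flat s2) l ->
  (\sum_(t <- s1) (wc f c t)%:Z = \sum_(t <- s2) (wc f c t)%:Z)%R.
Proof.
move=> t1 t2 ul lW h p1 p2; rewrite -!(big_morph Posz PoszD (erefl 0)); congr Posz.
apply: rigidW => //.
- by rewrite (perm_all_eq _ p1).
- by rewrite (perm_uniq p1).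
- by rewrite (permPl p1) perm_sym.
Qed.

(** Exchange [xab], [ya'b'] for [yab], [xa'b']: rigidity makes the effect of replacing [x] by [y]
    independent of the edge. *)
Lemma swap_disjoint x y a b a' b' : x \in W -> y \in W ->
  a \in W -> b \in W -> a' \in W -> b' \in W ->
  tri G (x, a, b) -> tri G (y, a, b) -> tri G (x, a', b') -> tri G (y, a', b') ->
  uniq [:: a; b; a'; b'; x; y] -> w x a b - w y a b = w x a' b' - w y a' b'.
Proof.
move=> xW yW aW bW aW' bW' t1 t2 t3 t4 ul.
have := @retile [:: (x, a, b); (y, a', b')] [:: (y, a, b); (x, a', b')] _ _ _ ul.
rewrite !big_cons !big_nil /= t1 t2 t3 t4 xW yW aW bW aW' bW' /w; move=> H.
suff : (wc f c (x, a, b))%:Z + ((wc f c (y, a', b'))%:Z + 0) =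
   (wc f c (y, a, b))%:Z + ((wc f c (x, a', b'))%:Z + 0) by clear; lia.
apply: H => //; apply/permP => P; rewrite /flat /=;
move: (P x : nat) (P y : nat) (P a : nat) (P b : nat) (P a' : nat) (P b' : nat); clear; lia.
Qed.

(** If the edges [ab] and [a'b'] meet, both are compared with a third edge disjoint from them. *)
Lemma swap_eq x y a b a' b' : x \in W -> y \in W ->
  a \in W -> b \in W -> a' \in W -> b' \in W ->
  tri G (x, a, b) -> tri G (y, a, b) -> tri G (x, a', b') -> tri G (y, a', b') ->
  w x a b - w y a b = w x a' b' - w y a' b'.
Proof.
case: (eqVneq x y) => [->|xy]; first by rewrite !subrr.
move=> xW yW aW bW aW' bW' t1 t2 t3 t4.
have [||||p [r [t5 t6 pW rW ur]]] := @edge_in_common x y (undup [:: x; y; a; b; a'; b']) => //.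
- exact: undup_uniq.
- by apply: leq_trans (size_undup _) _.
have ur' : [/\ uniq [:: p; r], p \notin [:: x; y; a; b; a'; b'] & r \notin [:: x; y; a; b; a'; b']].
  move: ur; rewrite !cons_uniq !inE !mem_undup negb_or !inE.
  by case/and3P=> /andP[-> ->] -> _.
have dis u v : u \in [:: x; y; a; b; a'; b'] -> v \in [:: x; y; a; b; a'; b'] ->
    tri G (x, u, v) -> tri G (y, u, v) -> uniq [:: p; r; u; v; x; y].
  case: ur' => upr pn rn uin vin /and3P[xu xv uv] /and3P[yu yv _].
  have ne z s : z \in [:: x; y; a; b; a'; b'] -> s \notin [:: x; y; a; b; a'; b'] -> s != z.
    by move=> zi; apply: contra => /eqP ->.
  have xin : x \in [:: x; y; a; b; a'; b'] by rewrite inE eqxx.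
  have yin : y \in [:: x; y; a; b; a'; b'] by rewrite !inE eqxx orbT.
  have pr : p != r by move: upr; rewrite /= inE andbT.
  rewrite !cons_uniq !inE !negb_or pr (ne u p) // (ne v p) // (ne x p) // (ne y p) //.
  rewrite (ne u r) // (ne v r) // (ne x r) // (ne y r) // (sgN uv).
  by rewrite ![u == _]eq_sym ![v == _]eq_sym (sgN xu) (sgN xv) (sgN yu) (sgN yv) xy.
have ain : a \in [:: x; y; a; b; a'; b'] by rewrite !inE eqxx !orbT.
have bin : b \in [:: x; y; a; b; a'; b'] by rewrite !inE eqxx !orbT.
have a'in : a' \in [:: x; y; a; b; a'; b'] by rewrite !inE eqxx !orbT.
have b'in : b' \in [:: x; y; a; b; a'; b'] by rewrite !inE eqxx !orbT.
rewrite -(@swap_disjoint x y p r a b) ?dis //.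
by rewrite -(@swap_disjoint x y p r a' b') ?dis.
Qed.

(** The default [(x, x)] is irrelevant for [x], [y] in [W], which have a common edge by
    [edge_in_common]. *)
Definition chosen_edge x y : V * V := odflt (x, x)
  [pick e : V * V | [&& tri G (x, e.1, e.2), tri G (y, e.1, e.2), e.1 \in W & e.2 \in W]].

Definition gain x y : int :=
  let e := chosen_edge x y in w x e.1 e.2 - w y e.1 e.2.

Lemma gainE x y a b : x \in W -> y \in W -> a \in W -> b \in W ->
  tri G (x, a, b) -> tri G (y, a, b) -> gain x y = w x a b - w y a b.
Proof.
move=> xW yW aW bW t1 t2; rewrite /gain /chosen_edge.
case: pickP => [[a' b'] /= /and4P[? ? ? ?]|/(_ (a, b))]; first exact: swap_eq.
by rewrite /= t1 t2 aW bW.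
Qed.

Lemma gainC x y : x \in W -> y \in W -> gain y x = - gain x y.
Proof.
move=> xW yW; have [a [b [t1 t2 aW bW _]]] := @edge_in_common x y [::] xW yW isT isT.
by rewrite (gainE xW yW aW bW) // (gainE yW xW aW bW) // opprB.
Qed.

(** A cyclic exchange of [x], [y], [z] over three disjoint edges. *)
Lemma gain_trans x y z : x \in W -> y \in W -> z \in W ->
  gain x z = gain x y + gain y z.
Proof.
have gxx u : gain u u = 0 by rewrite /gain subrr.
case: (eqVneq x y) => [->|xy]; first by rewrite gxx add0r.
case: (eqVneq y z) => [->|yz]; first by rewrite gxx addr0.
case: (eqVneq x z) => [<-|xz] xW yW zW; first by rewrite (gainC xW yW) gxx subrr.
have u0 : uniq [:: x; y; z] by rewrite /= !inE negb_or xy xz yz.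
have [a1 [b1 [t1 t1' a1W b1W u1]]] := edge_in_common xW yW u0 isT.
have [a2 [b2 [t2 t2' a2W b2W u2]]] := edge_in_common yW zW u1 isT.
have [a3 [b3 [t3 t3' a3W b3W u3]]] := edge_in_common xW zW u2 isT.
rewrite (gainE xW yW a1W b1W) // (gainE yW zW a2W b2W) // (gainE xW zW a3W b3W) //.
have := @retile [:: (x, a1, b1); (y, a2, b2); (z, a3, b3)]
  [:: (y, a1, b1); (z, a2, b2); (x, a3, b3)] _ _ _ u3.
rewrite !big_cons !big_nil /= t1 t2 t3 t1' t2' t3' xW yW zW a1W b1W a2W b2W a3W b3W => H.
suff : w x a1 b1 + (w y a2 b2 + (w z a3 b3 + 0)) = w y a1 b1 + (w z a2 b2 + (w x a3 b3 + 0)).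
  by move: (w x a1 b1) (w y a2 b2) (w z a3 b3) (w y a1 b1) (w z a2 b2) (w x a3 b3); clear; lia.
apply: H => //; apply/permP => P; rewrite /flat /=;
move: (P x : nat) (P y : nat) (P z : nat) (P a1 : nat) (P b1 : nat) (P a2 : nat) (P b2 : nat)
  (P a3 : nat) (P b3 : nat); clear; lia.
Qed.

(** Exchange the two triangles while swapping [a] with [a'], [b] with [b'] and [e] with [e'] over
    three fresh disjoint edges. *)
Lemma gain_triangles a b e a' b' e' : all (mem W) [:: a; b; e; a'; b'; e'] ->
  uniq [:: a; b; e; a'; b'; e'] -> tri G (a, b, e) -> tri G (a', b', e') ->
  w a b e = w a' b' e' + (gain a a' + gain b b' + gain e e').
Proof.
move=> lW u0 t t'; have := lW; rewrite /= andbT => /and5P[aW bW eW aW' /andP[bW' eW']].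
have [a1 [b1 [t1 t1' a1W b1W u1]]] := edge_in_common aW aW' u0 isT.
have [a2 [b2 [t2 t2' a2W b2W u2]]] := edge_in_common bW bW' u1 isT.
have [a3 [b3 [t3 t3' a3W b3W u3]]] := edge_in_common eW eW' u2 isT.
rewrite (gainE aW aW' a1W b1W) // (gainE bW bW' a2W b2W) // (gainE eW eW' a3W b3W) //.
have := @retile [:: (a, b, e); (a', a1, b1); (b', a2, b2); (e', a3, b3)]
  [:: (a', b', e'); (a, a1, b1); (b, a2, b2); (e, a3, b3)] _ _ _ u3.
rewrite !big_cons !big_nil /= t t' t1 t2 t3 t1' t2' t3' aW bW eW aW' bW' eW'.
rewrite a1W b1W a2W b2W a3W b3W => H.
suff : w a b e + (w a' a1 b1 + (w b' a2 b2 + (w e' a3 b3 + 0))) =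
    w a' b' e' + (w a a1 b1 + (w b a2 b2 + (w e a3 b3 + 0))).
  move: (w a b e) (w a' a1 b1) (w b' a2 b2) (w e' a3 b3) (w a' b' e')
    (w a a1 b1) (w b a2 b2) (w e a3 b3); clear; lia.
apply: H => //; apply/permP => P; rewrite /flat /=;
move: (P a : nat) (P b : nat) (P e : nat) (P a' : nat) (P b' : nat) (P e' : nat)
  (P a1 : nat) (P b1 : nat) (P a2 : nat) (P b2 : nat) (P a3 : nat) (P b3 : nat); clear; lia.
Qed.

Lemma triangle_avoiding A : (size A <= 14)%N -> exists a b e,
  [/\ tri G (a, b, e), all (mem W) [:: a; b; e] & all (fun x => x \notin A) [:: a; b; e]].
Proof.
move=> sA; have sA' : (size A <= 16)%N by apply: leq_trans sA _.
have [a [aW _ aA]] := @rich A [::] isT isT sA'.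
have [|b [bW /andP[ab _] bA]] := @rich A [:: a] _ isT sA'; first by rewrite /= aW.
have [|e [eW /and3P[ae be _] eA]] := @rich A [:: a; b] _ isT sA'; first by rewrite /= aW bW.
by exists a, b, e; rewrite /tri /= ab ae be aW bW eW aA bA eA.
Qed.

Lemma tri_uniq a b e : tri G (a, b, e) -> uniq [:: a; b; e].
Proof. by case/and3P => /= ab ae be; rewrite !inE negb_or (sgN ab) (sgN ae) (sgN be). Qed.

(** By [gain_trans], the gains relative to a base point [p0] are potentials. A triangle's count of
    color [c] minus its potentials is one constant [K], and [3 gain + K] distributes [K] over the
    vertices. *)
Lemma rigid_additive : exists Phi, tri_additive G W (fun x y => f [set x; y] == c) Phi.
Proof.
have [p0 [p1 [p2 [tp pW _]]]] := @triangle_avoiding [::] isT.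
have /and4P[p0W p1W p2W _] := pW.
pose K := w p0 p1 p2 - (gain p0 p0 + gain p1 p0 + gain p2 p0).
have disj a b e a' b' e' : tri G (a, b, e) -> tri G (a', b', e') ->
    all (mem W) [:: a; b; e] -> all (mem W) [:: a'; b'; e'] ->
    all (fun x => x \notin [:: a'; b'; e']) [:: a; b; e] ->
    w a b e - (gain a p0 + gain b p0 + gain e p0) =
    w a' b' e' - (gain a' p0 + gain b' p0 + gain e' p0).
  move=> t t' lW lW' dj.
  have -> : w a b e = w a' b' e' + (gain a a' + gain b b' + gain e e').
    apply: gain_triangles => //; first by rewrite (all_cat _ [:: a; b; e]) lW.
    rewrite (cat_uniq [:: a; b; e]) (tri_uniq t) (tri_uniq t') andbT andTb.
    by rewrite has_sym -all_predC; exact: dj.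
  have /and4P[aW bW eW _] := lW; have /and4P[aW' bW' eW' _] := lW'.
  rewrite (gain_trans aW aW' p0W) (gain_trans bW bW' p0W) (gain_trans eW eW' p0W).
  move: (gain a a') (gain b b') (gain e e') (gain a' p0) (gain b' p0) (gain e' p0)
    (w a' b' e'); clear; lia.
have KE a b e : tri G (a, b, e) -> all (mem W) [:: a; b; e] ->
    w a b e = gain a p0 + gain b p0 + gain e p0 + K.
  (* The triangle may meet the base triangle, so both are compared with a third one disjoint from
     them. *)
  move=> t lW; have [r0 [r1 [r2 [tr rW]]]] := @triangle_avoiding [:: a; b; e; p0; p1; p2] isT.
  move=> rA.
  have e1 := disj _ _ _ _ _ _ tr t rW lW.
  have e2 := disj _ _ _ _ _ _ tr tp rW pW.
  have {e2}e2 : w r0 r1 r2 - (gain r0 p0 + gain r1 p0 + gain r2 p0) = K.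
    apply: e2; apply: sub_all rA => x; apply: contra; rewrite !inE.
    by case/or3P=> ->; rewrite ?orbT.
  have {e1}e1 : w r0 r1 r2 - (gain r0 p0 + gain r1 p0 + gain r2 p0) =
      w a b e - (gain a p0 + gain b p0 + gain e p0).
    apply: e1; apply: sub_all rA => x; apply: contra; rewrite !inE.
    by case/or3P=> ->; rewrite ?orbT.
  rewrite e2 in e1; rewrite e1; clear; lia.
exists (fun v => 3 * gain v p0 + K) => a b e aW bW eW ab ae be.
have t : tri G (a, b, e) by rewrite /tri /= ab ae be.
have lW : all (mem W) [:: a; b; e] by rewrite /= aW bW eW.
have := KE _ _ _ t lW; rewrite {1}/w /wc /col /=.
by move=> ->; clear; lia.
Qed.
End Rigid.

Section Gadgets.
Variables (V : finType) (G : sgraph V) (q : nat) (f : {set V} -> 'I_q).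
Implicit Types (A B D W : {set V}).

Definition tiles (s : seq (V * V * V)) D := all (tri G) s && perm_eq (flat s) (enum D).

Lemma tilesU A B s1 s2 : [disjoint A & B] -> tiles s1 A -> tiles s2 B ->
  tiles (s1 ++ s2) (A :|: B).
Proof.
move=> dAB /andP[t1 p1] /andP[t2 p2]; rewrite /tiles all_cat t1 t2 flat_cat /=.
apply: perm_trans (perm_cat p1 p2) _; apply: uniq_perm; rewrite ?enum_uniq //.
  rewrite cat_uniq !enum_uniq andbT /=; apply/hasPn => v; rewrite !mem_enum => vB.
  by apply/negP => /= vA; move/pred0P: dAB => /(_ v); rewrite /= vA vB.
by move=> v; rewrite mem_cat !mem_enum inE.
Qed.

Lemma tiles_size s D : tiles s D -> 3 * size s = #|D|.
Proof. by case/andP=> _ p; rewrite -size_flat (perm_size p) cardE. Qed.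

Lemma cnt_weights s W c Phi : tri_additive G W (fun x y => f [set x; y] == c) Phi ->
  tiles s W -> (3 * (cnt f c s)%:Z = \sum_(v in W) Phi v)%R.
Proof.
move=> add /andP[ts ps]; rewrite -big_enum -(perm_big _ ps) /=.
have sW : all (mem W) (flat s).
  by rewrite (perm_all_eq _ ps); apply/allP => v; rewrite mem_enum.
rewrite /cnt; elim: s ts sW {ps} => [|[[x y] z] s IH]; first by rewrite !big_nil.
rewrite flat_cons !big_cons /= => /andP[/and3P[/= xy xz yz] ts] /and4P[xW yW zW sW].
have := add x y z xW yW zW xy xz yz; rewrite -/(wc f c (x, y, z)) => e.
rewrite PoszD mulrDr IH // addrA addrA -e /wc /col /=; congr (_ + _)%R.
Qed.

(** [m c] counts the disjoint gadgets for which [c] is the chosen color with different counts. For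
    each [c], the better and the worse tilings of these gadgets give two tilings of [D] whose counts
    of [c] differ by at least [m c]; a failure of rigidity outside [D] supplies the next gadget. *)
Lemma gadget_iter t : exists D (m : 'I_q -> nat),
  [/\ #|D| <= 12 * \sum_c m c, \sum_c m c <= t,
    forall c, exists s1 s2, [/\ tiles s1 D, tiles s2 D & cnt f c s2 + m c <= cnt f c s1]
    & \sum_c m c = t \/ rigid G f (~: D)].
Proof.
elim: t => [|t [D [m [cD mt sw end_]]]].
  exists set0, (fun=> 0); rewrite cards0 big1 //; split=> //; last by left.
  by move=> c; exists [::], [::]; rewrite /tiles enum_set0 addn0.
case: end_ => [mE|rg]; last by exists D, m; split=> //; [exact: leqW | right].
case: (pselect (exists s1 s2 c, [/\ all (tri G) s1, all (tri G) s2,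
    all (mem (~: D)) (flat s1), uniq (flat s1) &
    [/\ perm_eq (flat s1) (flat s2), size s1 <= 4 & cnt f c s1 <> cnt f c s2]])) => [|no]; last first.
  exists D, m; split=> //; [exact: leqW | right] => s1 s2 t1 t2 aD us ps sz c.
  apply/eqP/negPn/negP => /eqP ne; apply: no.
  by exists s1, s2, c.
move=> [s1 [s2 [c [t1 t2 aD us [ps sz ne]]]]].
pose D' := [set v in flat s1].
have p1 : perm_eq (flat s1) (enum D').
  by apply: uniq_perm => //; [exact: enum_uniq | move=> v; rewrite mem_enum inE].
have g1 : tiles s1 D' by rewrite /tiles t1.
have g2 : tiles s2 D' by rewrite /tiles t2 -(permPl ps).
have [r1 [r2 [h1 h2 lt12]]] : exists r1 r2, [/\ tiles r1 D', tiles r2 D' & cnt f c r2 < cnt f c r1].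
  case: (ltngtP (cnt f c s1) (cnt f c s2)) ne => // lt _.
    by exists s2, s1.
  by exists s1, s2.
have dis : [disjoint D & D'].
  apply/pred0P => v /=; apply/negbTE/negP => /andP[vD]; rewrite inE => /(allP aD).
  by rewrite /= inE vD.
have sumE : \sum_c' (m c' + (c' == c)) = (\sum_c' m c').+1.
  rewrite big_split /= -addn1; congr (_ + _).
  by rewrite (bigD1 c) //= eqxx big1 // => c' /negbTE ->.
exists (D :|: D'), (fun c' => m c' + (c' == c)); rewrite sumE; split.
- apply: leq_trans (leq_card_setU _ _) _; rewrite mulnS addnC; apply: leq_add => //.
  by rewrite -(tiles_size g1) (_ : 12 = 3 * 4) // leq_mul2l.
- by rewrite mE.
- move=> c'; have [s3 [s4 [h3 h4 h34]]] := sw c'.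
  case: (eqVneq c' c) => [e|_].
    exists (s3 ++ r1), (s4 ++ r2); split; try exact: tilesU.
    by move: h34 lt12; rewrite e !cnt_cat; clear; lia.
  exists (s3 ++ r1), (s4 ++ r1); split; try exact: tilesU.
  by rewrite !cnt_cat addn0 addnAC leq_add2r.
- by left; rewrite mE.
Qed.
End Gadgets.

(** * Assembling a full tiling in which some color is frequent *)

Lemma cnt_tiling (V : finType) (G : sgraph V) q (f : {set V} -> 'I_q) s :
  tiles G s [set: V] -> \sum_c cnt f c s = #|V|.
Proof. by move=> h; rewrite sum_cnt (tiles_size h) cardsT. Qed.

(** If [c] has less than [(n + e)/q] edges in [s1], it has so few in [s2] that some other color must
    reach [(n + e)/q] there, the total being [n]. *)
Lemma unbalanced_tiling (V : finType) (G : sgraph V) q (f : {set V} -> 'I_q) c s1 s2 e m :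
  tiles G s1 [set: V] -> tiles G s2 [set: V] -> cnt f c s2 + m <= cnt f c s1 ->
  q * e <= q * m -> exists s c', tiles G s [set: V] /\ #|V| + e <= q * cnt f c' s.
Proof.
move=> h1 h2 h12 hm; case: (leqP (#|V| + e) (q * cnt f c s1)) => [h|lt1].
  by exists s1, c.
case: (pickP (fun c' => #|V| + e <= q * cnt f c' s2)) => [c' h|no].
  by exists s2, c'.
exfalso; have : \sum_(c' | c' != c) q * cnt f c' s2 <= \sum_(c' | c' != c) (#|V| + e).
  by apply: leq_sum => c' _; rewrite ltnW // ltnNge no.
rewrite sum_nat_const cardC1 card_ord -big_distrr /=.
have := cnt_tiling f h2; rewrite (bigD1 c) //= => E; move: lt1 hm h12; rewrite -E {E}.
have : 0 < q by exact: leq_ltn_trans (leq0n c) (ltn_ord c).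
move: (cnt f c s1) (cnt f c s2) (\sum_(i | _) _) => x1 x2 y; clear.
case: q => // q' _; rewrite succnK => lt1 hm h12 h.
have : q'.+1 * (x2 + m) <= q'.+1 * x1 by rewrite leq_mul2l h12 orbT.
by move: lt1 hm h; rewrite !mulSn !mulnDr; clear; lia.
Qed.

Lemma slack_gap h n w d : 0 < h -> (2 * h + 1) * n <= 3 * h * d -> w <= n -> 0 < w ->
  2 * w < 3 * d.
Proof.
move=> h0 hd wn w0; have : h * (2 * w) < h * (3 * d); last by rewrite ltn_pmul2l.
have : h * w <= h * n by rewrite leq_mul2l wn orbT.
by move: hd wn w0; clear; lia.
Qed.

(** Seek [q * e] gadgets. If they exist, some color owns at least [e] of them and the tiling can be
    unbalanced; otherwise the rest is rigid with minimum degree at least [d - 12qe], and the color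
    bounds apply to it. *)
Theorem tiling_with_frequent_color q h : 0 < h -> exists N,
  forall (V : finType) (G : sgraph V) (f : {set V} -> 'I_q) d e,
  N <= #|V| -> 3 %| #|V| -> (forall v, d <= dg G [set: V] v) ->
  (2 * h + 1) * #|V| <= 3 * h * d -> 72 * h * (q * e) <= #|V| ->
  exists s, tiles G s [set: V] /\ ((exists c, #|V| + e <= q * cnt f c s) \/
    (exists c, 2 * (d - 12 * (q * e)) <= #|V| + 3 * cnt f c s) /\
    (3 * #|V| < 4 * (d - 12 * (q * e)) ->
      exists c s', tiles G s' [set: V] /\ 2 * (d - 12 * (q * e)) <= #|V| + cnt f c s')).
Proof.
move=> h0; have h20 : 0 < 2 * h by rewrite muln_gt0.
have [N HN] := tiling_exists h20; exists (2 * N + 40 * h) => V G f d e hN d3 dV hd he.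
set t := q * e in he *; set n := #|V| in hN d3 hd he *.
have [D [m [cD mt sw end_]]] := gadget_iter G f t.
set W := ~: D.
have cDt : #|D| <= 12 * t by apply: leq_trans cD _; rewrite leq_mul2l mt orbT.
have cWD : #|D| + #|W| = n by rewrite cardsC.
have ht : 72 * t <= n.
  by apply: leq_trans he; rewrite -mulnA (mulnC h) mulnA leq_pmulr.
(* Half of the slack survives the removal of [D]: it costs [6h * 12t = 72ht], at most [n]. *)
have hd' : (2 * (2 * h) + 1) * n <= 3 * (2 * h) * (d - 12 * t).
  have : 6 * h * d <= 6 * h * (d - 12 * t + 12 * t).
    by rewrite leq_mul2l; apply/orP; right; clear; lia.
  by move: hd he; rewrite mulnDr; move: (d - 12 * t) => d'; clear; lia.
have c0 : 'I_q by exact: f set0.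
have [s0 [_ [tD _ _]]] := sw c0.
have dWv v : d - 12 * t <= dg G W v.
  rewrite leq_subLR addnC; apply: leq_trans (dV v) _.
  apply: leq_trans (_ : dg G W v + #|D| <= _); last by rewrite leq_add2l.
  rewrite /dg; apply: leq_trans (leq_card_setU _ _); apply/subset_leq_card/subsetP => u.
  by rewrite !inE /= => ->; rewrite andbT orNb.
have wn : #|W| <= n by rewrite -cWD leq_addl.
have dnsW : dense G W (2 * h) 1.
  move=> v _; apply: leq_trans (_ : (2 * (2 * h) + 1) * n <= _).
    by rewrite leq_mul2l wn orbT.
  by apply: leq_trans hd' _; rewrite leq_mul2l dWv orbT.
have w32 : 32 * h < #|W| by move: hN cWD cDt ht h0; clear; lia.
have d3W : 3 %| #|W| by rewrite -(dvdn_addr #|W| (_ : 3 %| #|D|)) ?cWD // -(tiles_size tD) dvdn_mulr.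
have [sW tsW psW] : tileable G W.
  by apply: HN => //; move: hN cWD cDt ht; clear; lia.
have tW : tiles G sW W by rewrite /tiles tsW.
have full s : tiles G s D -> tiles G (s ++ sW) [set: V].
  move=> ts; rewrite -(setUCr D); apply: tilesU => //.
  by rewrite -setI_eq0 setICr.
case: end_ => [mE|rg].
  have [c hc] : exists c, t <= q * m c.
    case: (pickP (fun c => t <= q * m c)) => [c hc|no]; first by exists c.
    exfalso; have : \sum_c (q * m c).+1 <= \sum_(c < q) t.
      by apply: leq_sum => c _; rewrite ltnNge no.
    under eq_bigr do rewrite -addn1.
    rewrite big_split /= -big_distrr /= mE !sum_nat_const card_ord muln1.
    have : 0 < q by exact: leq_ltn_trans (leq0n c0) (ltn_ord c0).
    by clear; lia.
  have [s1 [s2 [h1 h2 h12]]] := sw c.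
  have [||s [c' [ts hs]]] := @unbalanced_tiling _ G q f c (s1 ++ sW) (s2 ++ sW) e (m c)
    (full _ h1) (full _ h2).
  - by rewrite !cnt_cat addnAC leq_add2r.
  - exact: hc.
  by exists s; split=> //; left; exists c'.
exists (s0 ++ sW); split; first exact: full.
right.
have W0 : 0 < #|W| by apply: leq_ltn_trans w32.
have rich (A xs : seq V) : all (mem W) xs -> size xs <= 3 -> size A <= 16 ->
    exists u, [/\ u \in W, all (G^~ u) xs & u \notin A].
  move=> xsW sxs sA; have hcn := cn3 h20 dnsW xsW sxs.
  have : 16 < #|cn G W xs|.
    rewrite ltnNge; apply/negP => c16; move: (leq_trans w32 hcn).
    by rewrite ltnNge => /negP; apply; rewrite (mulnC 2) -!mulnA (mulnC 32) leq_mul2l;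
      apply/orP; right; move: c16; clear; lia.
  move=> h16; have : 0 < #|cn G W xs :\: [set x in A]|.
    have : #|[set x in A]| <= 16 by rewrite cardsE; apply: leq_trans (card_size _) sA.
    have := cardsID [set x in A] (cn G W xs).
    have := subset_leq_card (subsetIr (cn G W xs) [set x in A]).
    by move: h16; clear; lia.
  case/card_gt0P => u; rewrite in_setD in_set [u \in cn _ _ _]in_set.
  by case/and3P=> uA uW uxs; exists u.
have [Phi HPhi] := choice (rigid_additive rg rich).
have d3' : 2 * #|W| < 3 * (d - 12 * t).
  exact: slack_gap h20 hd' wn W0.
have dW v : v \in W -> d - 12 * t <= dg G W v by [].
split.
  have [c hc] := color_bound dW W0 d3' HPhi; exists c; move: hc.
  rewrite -(cnt_weights (HPhi c) tW) cnt_cat.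
  by move: wn; move: (d - 12 * t) (cnt f c sW) (cnt f c s0); clear; lia.
move=> d4; have [|c hc] := color_bound_dense dW W0 d3' HPhi.
  by move: wn d4; clear; lia.
exists c, (s0 ++ sW); split; first exact: full.
move: hc; rewrite -(cnt_weights (HPhi c) tW) cnt_cat.
by move: wn; move: (d - 12 * t) (cnt f c sW) (cnt f c s0); clear; lia.
Qed.

(** * Tilings as set partitions *)

Section Bridge.
Variables (V : finType) (G : sgraph V).
Implicit Types (P : {set {set V}}) (B : {set V}) (p : pred {set V}).

Definition pairs_in p B := [set e : {set V} | [&& e \subset B, #|e| == 2 & p e]].

Lemma edges_tiling P e : (e \in edges (tiling_graph P)) =
  (#|e| == 2) && [exists B in P, e \subset B].
Proof.
apply/idP/idP.
  rewrite inE => /existsP[x /existsP[y /andP[/andP[xy /existsP[B /and3P[BP xB yB]]] /eqP ->]]].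
  rewrite cards2 xy /=; apply/existsP; exists B; rewrite BP /=.
  by apply/subsetP => z; rewrite !inE => /orP[] /eqP ->.
case/andP=> /cards2P[x [y [xy ->]]] /existsP[B /andP[BP sB]].
rewrite inE; apply/existsP; exists x; apply/existsP; exists y; rewrite eqxx andbT.
apply/andP; split=> //; apply/existsP; exists B.
by rewrite BP !(subsetP sB) // !inE eqxx ?orbT.
Qed.

Lemma card_edges_tiling P p : finset.partition P [set: V] ->
  #|[set e in edges (tiling_graph P) | p e]| = \sum_(B in P) #|pairs_in p B|.
Proof.
case/and3P=> _ tP _.
pose F B := if B \in P then pairs_in p B else set0.
have -> : [set e in edges (tiling_graph P) | p e] = \bigcup_B F B.
  apply/setP => e; rewrite in_set edges_tiling; apply/idP/bigcupP.
    case/andP=> /andP[e2 /existsP[B /andP[BP sB]]] pe.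
    by exists B; rewrite // /F BP inE sB e2.
  case=> B _; rewrite /F; case: ifP => BP; rewrite inE // => /and3P[sB -> ->].
  by rewrite andbT /=; apply/existsP; exists B; rewrite BP.
rewrite -sum1_card partition_disjoint_bigcup /=.
  rewrite [RHS]big_mkcond /=; apply: eq_bigr => B _; rewrite sum1_card /F.
  by case: ifP => // _; rewrite cards0.
move=> B B' ne; rewrite /F; case: ifP => BP; last by rewrite disjoints_subset sub0set.
case: ifP => BP'; last by rewrite disjoint_sym disjoints_subset sub0set.
apply/pred0P => e /=; apply/negbTE/negP; rewrite !inE.
case/andP=> /and3P[sB /cards2P[x [y [xy eE]]] _] /and3P[sB' _ _].
have xe : x \in e by rewrite eE !inE eqxx.
move/trivIsetP: tP => /(_ _ _ BP BP' ne) /pred0P /(_ x).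
by rewrite /= (subsetP sB) // (subsetP sB').
Qed.

Lemma card_pairs_in p x y z : x != y -> x != z -> y != z ->
  #|pairs_in p [set x; y; z]| = p [set x; y] + p [set x; z] + p [set y; z].
Proof.
move=> xy xz yz.
have E : pairs_in p [set x; y; z] = [set e in [:: [set x; y]; [set x; z]; [set y; z]] | p e].
  apply/setP => e; rewrite !in_set andbA; congr (_ && _); apply/idP/idP; last first.
    rewrite !inE => /or3P[] /eqP ->; rewrite cards2 ?xy ?xz ?yz andbT;
    by apply/subsetP => u; rewrite !inE => /orP[] ->; rewrite ?orbT.
  case/andP=> sB /cards2P[u [v [uv eE]]]; move: sB uv; rewrite eE => /subsetP sB.
  have := sB u; have := sB v; rewrite !inE !eqxx ?orbT /= => /(_ isT) hv /(_ isT) hu.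
  case/orP: hu => [/orP[]|] /eqP ->; case/orP: hv => [/orP[]|] /eqP ->;
    rewrite ?eqxx ?orbT // => _; by rewrite 1?[[set _; _]]setUC ?eqxx ?orbT //.
have ne (a b c d : V) : a \notin [set c; d] -> [set a; b] != [set c; d].
  by apply: contra => /eqP <-; rewrite !inE eqxx.
have n1 : [set x; y] != [set x; z].
  by rewrite setUC ne // !inE negb_or eq_sym xy yz.
have n2 : [set x; y] != [set y; z] by rewrite ne // !inE negb_or xy xz.
have n3 : [set x; z] != [set y; z] by rewrite ne // !inE negb_or xy xz.
rewrite E; set L := [:: _; _; _].
have -> : [set e in L | p e] = [set e in filter p L].
  by apply/setP => e; rewrite !in_set mem_filter andbC.
rewrite cardsE (card_uniqP _); last by rewrite filter_uniq //= !inE negb_or n1 n2 n3.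
by rewrite size_filter /= addn0 addnA.
Qed.

Lemma Kr_copy3 B : is_Kr_copy G 3 B -> exists x y z, [/\ B = [set x; y; z],
  G x y, G x z & G y z].
Proof.
case/andP=> /eqP B3 /forall_inP cl.
have : size (enum B) = 3 by rewrite -cardE.
case eB: (enum B) => [|x [|y [|z [|]]]] // _.
have xB u : (u \in B) = (u \in [:: x; y; z]) by rewrite -eB mem_enum.
have := enum_uniq B; rewrite eB /= !inE negb_or andbT => /andP[/andP[xy xz] yz].
have adj u v : u \in [:: x; y; z] -> v \in [:: x; y; z] -> u != v -> G u v.
  by rewrite -!xB => uB vB; have /forall_inP/(_ v vB)/implyP := cl u uB.
exists x, y, z; split; try by apply: adj; rewrite // !inE eqxx ?orbT.
by apply/setP => u; rewrite xB !inE orbA.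
Qed.

Definition blocks (s : seq (V * V * V)) := [set [set t.1.1; t.1.2; t.2] | t in s].

Lemma flat_inj (s : seq (V * V * V)) t t' v : uniq (flat s) -> t \in s -> t' \in s ->
  v \in flat [:: t] -> v \in flat [:: t'] -> t = t'.
Proof.
elim: s => // u s IH; rewrite (flat_cat [:: u]) cat_uniq => /and3P[_ /hasPn h us].
have mem w : w \in s -> v \in flat [:: w] -> v \in flat s.
  move=> ws vw; apply/flattenP; exists (flat [:: w]) => //.
  by apply/mapP; exists w.
rewrite ![_ \in u :: s]in_cons => /orP[/eqP ->|ts] /orP[/eqP ->|ts'] // vt vt'.
- by have := h v (mem _ ts' vt'); rewrite /= vt.
- by have := h v (mem _ ts vt); rewrite /= vt'.
- exact: IH.
Qed.

Lemma in_block (t : V * V * V) v : (v \in [set t.1.1; t.1.2; t.2]) = (v \in flat [:: t]).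
Proof. by rewrite !inE orbA. Qed.

Lemma blocks_tiling s : tiles G s [set: V] -> is_Kr_tiling G 3 (blocks s).
Proof.
case/andP=> /allP ts ps; have us : uniq (flat s) by rewrite (perm_uniq ps) enum_uniq.
apply/andP; split; last first.
  apply/forall_inP => B /imsetP[t /ts /and3P[ab ac bc] ->].
  apply/andP; split.
    by rewrite -setUA cardsU1 cards2 !inE negb_or (sgN ab) (sgN ac) (sgN bc).
  apply/forall_inP => u; rewrite in_block !inE => /or3P[] /eqP ->; apply/forall_inP => v;
    rewrite in_block !inE => /or3P[] /eqP ->; apply/implyP; rewrite ?eqxx // => _ //;
    by rewrite sgC.
apply/and3P; split.
- rewrite eqEsubset subsetT /=; apply/subsetP => v _.
  have : v \in flat s by rewrite (perm_mem ps) mem_enum inE.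
  case/flattenP => l /mapP[t t_s ->] vt; apply/bigcupP.
  by exists [set t.1.1; t.1.2; t.2]; [apply: imset_f | rewrite in_block].
- apply/trivIsetP => B B' /imsetP[t t_s ->] /imsetP[t' t's ->] ne.
  apply/pred0P => v /=; apply/negbTE/negP; rewrite !in_block => /andP[vt vt'].
  by move: ne; rewrite (flat_inj us t_s t's vt vt') eqxx.
- apply/negP => /imsetP[t _ /setP/(_ t.1.1)].
  by rewrite in_block !inE eqxx.
Qed.

Lemma card_color_blocks q (f : {set V} -> 'I_q) s c : tiles G s [set: V] ->
  #|color_class (tiling_graph (blocks s)) f c| = cnt f c s.
Proof.
move=> h; have /andP[pP _] := blocks_tiling h; case/andP: h => /allP ts ps.
have us : uniq (flat s) by rewrite (perm_uniq ps) enum_uniq.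
have uss : uniq s.
  elim: (s) us => // t s' IH; rewrite (flat_cat [:: t]) cat_uniq => /and3P[_ /hasPn h us'].
  rewrite /= IH // andbT; apply/negP => t_s.
  have : t.1.1 \in flat s' by apply/flattenP; exists (flat [:: t]);
    [apply/mapP; exists t | rewrite inE eqxx].
  by move/h; rewrite /= inE eqxx.
rewrite (card_edges_tiling (fun e => f e == c) pP) /blocks big_imset /=; last first.
  move=> t t' t_s t's e; apply: (@flat_inj s t t' t.1.1) => //; first by rewrite inE eqxx.
  by rewrite -in_block -e in_block inE eqxx.
rewrite -big_uniq //= /cnt big_seq [RHS]big_seq; apply: eq_bigr => t /ts /and3P[ab ac bc].
by rewrite card_pairs_in ?(sgN ab) ?(sgN ac) ?(sgN bc).
Qed.

Lemma card_edges_Kr3 P : is_Kr_tiling G 3 P -> #|edges (tiling_graph P)| = #|V|.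
Proof.
case/andP=> pP /forall_inP clP.
have -> : edges (tiling_graph P) = [set e in edges (tiling_graph P) | predT e].
  by apply/setP => e; rewrite [RHS]inE andbT.
rewrite card_edges_tiling // -cardsT (card_partition pP); apply: eq_bigr => B /clP cB.
have [x [y [z [-> xy xz yz]]]] := Kr_copy3 cB.
rewrite card_pairs_in ?(sgN xy) ?(sgN xz) ?(sgN yz) //.
by rewrite -setUA cardsU1 cards2 !inE negb_or (sgN xy) (sgN xz) (sgN yz).
Qed.

Lemma card_color_weights q (f : {set V} -> 'I_q) c Phi P :
  tri_additive G [set: V] (fun x y => f [set x; y] == c) Phi -> is_Kr_tiling G 3 P ->
  (3 * (#|color_class (tiling_graph P) f c|)%:Z = \sum_v Phi v)%R.
Proof.
move=> add /andP[pP /forall_inP clP].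
rewrite (card_edges_tiling (fun e => f e == c) pP).
rewrite (big_morph Posz PoszD (erefl 0%R)) mulr_sumr.
have -> : (\sum_v Phi v = \sum_(v in [set: V]) Phi v)%R by apply: eq_bigl => v; rewrite inE.
rewrite (set_partition_big _ pP) /=; apply: eq_bigr => B /clP cB.
have [x [y [z [-> xy xz yz]]]] := Kr_copy3 cB.
rewrite card_pairs_in ?(sgN xy) ?(sgN xz) ?(sgN yz) // (add x y z) ?inE //.
rewrite -setUA big_setU1 ?inE ?negb_or ?(sgN xy) ?(sgN xz) //=.
by rewrite big_setU1 ?inE ?(sgN yz) //= big_set1 addrA.
Qed.
End Bridge.

Lemma min_degree_le (V : finType) (G : sgraph V) v : min_degree G <= degree G v.
Proof.
rewrite /min_degree; elim: (index_enum V) (mem_index_enum v) => // u s IH.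
rewrite inE big_cons => /orP[/eqP ->|/IH h]; first exact: geq_minl.
exact: leq_trans (geq_minr _ _) h.
Qed.

Lemma min_degree_ind (V : finType) (G : sgraph V) (Q : nat -> Prop) : Q #|V| ->
  (forall v, Q (degree G v)) -> Q (min_degree G).
Proof.
move=> QV Qd; rewrite /min_degree; elim/big_ind: _ => // x y Qx Qy.
by rewrite /minn; case: ifP.
Qed.

(** * Extremal examples *)

Section Pattern.
Variables (q' : nat) (pat : seq nat).

(* Vertices of type 0, 1, 2 form three classes of the 4-partite graph; all
   vertices of type at least 3 form the fourth class, and all edges at a vertex
   of type [c + 3] have color [c]. *)
Definition part (t : nat) : nat := match t with 0 => 0 | 1 => 1 | 2 => 2 | _ => 3 end.

(** On the first three classes, [a + b - 1] numbers the pairs 01, 02, 12 by 0, 1, 2; the cap at [q']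
    repeats a color when there are only two. *)
Definition pair_color (a b : nat) : nat :=
  match a with a'.+3 => a' | _ =>
  match b with b'.+3 => b' | _ => minn (a + b).-1 q' end end.

Definition special (c k : nat) : nat := minn k q' == c.
Definition specials c : nat := special c 0 + special c 1 + special c 2.

(** The tripled weight that solves the additivity equations: a vertex of one of the first three
    classes loses the pair opposite to it, and one of the fourth class gains 6 for its two edges of
    color [c] in each triangle. *)
Definition pat_weight (c t : nat) : int :=
  match t with
  | 0 => 2%:Z * (specials c)%:Z - 3%:Z * (special c 2)%:Z
  | 1 => 2%:Z * (specials c)%:Z - 3%:Z * (special c 1)%:Z
  | 2 => 2%:Z * (specials c)%:Z - 3%:Z * (special c 0)%:Z
  | t'.+3 => 6%:Z * (t' == c : nat)%:Z - (specials c)%:Z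
  end%R.

(** The third clause says that every color has exactly [n/q] edges in every tiling of a blow-up, the
    fourth that the minimum degree is at least [num/den] of the order. The use of [foldr] and [iota]
    lets concrete patterns be checked by evaluation. *)
Definition balanced_pattern (num den : nat) : bool :=
  [&& 0 < size pat, all (fun t => t < q'.+4) pat,
    all (fun c => (q'.+1)%:Z * foldr (fun t a => pat_weight c t + a) 0 pat
      == 3%:Z * (size pat)%:Z)%R (iota 0 q'.+1) &
    all (fun p => num * size pat <= den * count (fun t => part t != p) pat) (iota 0 4)].

Variable k : nat.
Let n := (size pat * k)%N.
Definition ptype (v : nat) := nth 0 pat (v %% size pat).

Definition pattern_adj : rel 'I_n := fun x y => part (ptype x) != part (ptype y).

Lemma pattern_adj_sym : symmetric pattern_adj.
Proof. by move=> x y; rewrite /pattern_adj eq_sym. Qed.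

Lemma pattern_adj_irr : irreflexive pattern_adj.
Proof. by move=> x; rewrite /pattern_adj eqxx. Qed.

Definition pattern_graph : sgraph 'I_n := SGraph pattern_adj_sym pattern_adj_irr.

Definition pattern_color (e : {set 'I_n}) : 'I_q'.+1 :=
  inord (if [pick z in e | 2 < ptype z] is Some z then ptype z - 3
         else minn (\sum_(z in e) ptype z).-1 q').

Lemma ptype_lt num den v : balanced_pattern num den -> ptype v < q'.+4.
Proof.
case/and4P=> M0 /allP ap _ _; apply: ap; apply: mem_nth; exact: ltn_pmod.
Qed.

Lemma pattern_colorE num den (x y : 'I_n) : balanced_pattern num den ->
  pattern_adj x y -> pattern_color [set x; y] = pair_color (ptype x) (ptype y) :> nat.
Proof.
move=> ok; rewrite /pattern_adj => xy.
have nxy : x != y by apply: contraNneq xy => ->.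
have hx := ptype_lt x ok; have hy := ptype_lt y ok.
rewrite /pattern_color; case: pickP => [z|none].
  rewrite !inE => /andP[/orP[] /eqP -> hz].
    rewrite inordK; last by move: hx hz; clear; lia.
    by case: (ptype x) hz => [|[|[|a]]] // _; rewrite !subSS subn0.
  rewrite inordK; last by move: hy hz; clear; lia.
  case: (ptype y) hz xy => [|[|[|a]]] // _; rewrite !subSS subn0.
  by case: (ptype x) => [|[|[|b]]].
have sx : ptype x <= 2 by have := none x; rewrite !inE eqxx /= ltnNge => /negbFE.
have sy : ptype y <= 2 by have := none y; rewrite !inE eqxx orbT /= ltnNge => /negbFE.
rewrite inordK ?ltnS ?geq_minr // big_setU1 ?inE //= big_set1.
by case: (ptype x) sx => [|[|[|]]] //; case: (ptype y) sy => [|[|[|]]].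
Qed.

Lemma pair_color_weight c a b e : part a != part b -> part a != part e -> part b != part e ->
  (3%:Z * ((pair_color a b == c) + (pair_color a e == c) + (pair_color b e == c))%N%:Z =
   pat_weight c a + pat_weight c b + pat_weight c e)%R.
Proof.
have E i : (minn i q' == c : nat) = special c i by [].
case: a => [|[|[|a]]]; case: b => [|[|[|b]]]; case: e => [|[|[|e]]] //= _ _ _;
rewrite ?addnS ?addn0 ?add0n /= ?E /specials;
move: (special c 0) (special c 1) (special c 2) => s0 s1 s2; clear E; lia.
Qed.

Lemma pattern_additive num den (c : 'I_q'.+1) : balanced_pattern num den ->
  tri_additive pattern_graph [set: 'I_n] (fun x y => pattern_color [set x; y] == c)
    (fun v => pat_weight c (ptype v)).
Proof.
move=> ok x y z _ _ _ xy xz yz.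
rewrite -!(inj_eq val_inj) /= !(pattern_colorE ok) //.
exact: pair_color_weight.
Qed.

Lemma sum_ptype (F : nat -> int) :
  (\sum_(v < n) F (ptype v) = (\sum_(t <- pat) F t) *+ k)%R.
Proof.
rewrite -(big_mkord xpredT (fun v => F (ptype v))) /n; elim: k => [|k' IH].
  by rewrite muln0 big_nil.
rewrite mulrSr mulnSr (@big_cat_nat _ _ _ (size pat * k')) ?leq_addr //= IH; congr (_ + _)%R.
rewrite -{1}[size pat * k']add0n big_addn addKn [RHS](big_nth 0).
apply: eq_big_nat => i /andP[_ hi].
by rewrite /ptype addnC mulnC modnMDl modn_small.
Qed.

Lemma balance_arith (a x m j : nat) (S : int) :
  (3 * x%:Z = S *+ j -> a%:Z * S = 3%:Z * m%:Z -> (a * x = m * j)%N)%R.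
Proof.
rewrite -[(S *+ j)%R]mulr_natr natz => h1 h2; apply/eqP; rewrite -(eqr_nat int) !natz !PoszM.
have : (3 * (a%:Z * x%:Z) = 3 * (m%:Z * j%:Z))%R by rewrite mulrCA h1 !mulrA h2; clear; lia.
by clear; lia.
Qed.

Lemma pattern_balanced num den P c : balanced_pattern num den ->
  is_Kr_tiling pattern_graph 3 P ->
  q'.+1 * #|color_class (tiling_graph P) pattern_color c| = n.
Proof.
move=> ok tP; have := card_color_weights (pattern_additive c ok) tP.
rewrite (sum_ptype (pat_weight c)) => h.
case/and4P: ok => _ _ /allP/(_ (val c)) ok _.
have : (val c) \in iota 0 q'.+1 by rewrite mem_iota /=.
move/ok/eqP; have -> : foldr (fun t a => (pat_weight (val c) t + a)%R) 0%R pat =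
    (\sum_(t <- pat) pat_weight c t)%R.
  by rewrite unlock /reducebig; elim: (pat) => //= t s ->.
by move=> hS; apply: (balance_arith h hS).
Qed.

Lemma pattern_degree num den v : balanced_pattern num den ->
  num * n <= den * degree pattern_graph v.
Proof.
case/and4P=> M0 _ _ /allP/(_ (part (ptype v))) ok.
have : part (ptype v) \in iota 0 4 by rewrite mem_iota; case: (ptype v) => [|[|[|]]].
move/ok => hd; have -> : degree pattern_graph v = count (fun t => part t != part (ptype v)) pat * k.
  apply/eqP; rewrite -(eqr_nat int) !natz /degree -sum1_card big_mkcond /=.
  rewrite (big_morph Posz PoszD (erefl 0%R)) /=.
  pose F t : int := Posz (part t != part (ptype v)).
  rewrite (eq_bigr (fun w : 'I_n => F (ptype w))) => [|w _]; last first.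
    by rewrite inE /= /pattern_adj eq_sym /F; case: (_ != _).
  rewrite (sum_ptype F) -mulr_natr natz PoszM; apply/eqP; congr (_ * _)%R.
  elim: (pat) => [|t s IH]; first by rewrite big_nil.
  by rewrite big_cons IH /= PoszD.
by rewrite /n !mulnA leq_mul2r hd orbT.
Qed.
End Pattern.

(** Four classes of size [3q]. Balance of color [c] requires [6 - q * specials] vertices of that
    color in the fourth class, which is nonnegative exactly up to [q = 6]. *)
Definition pattern_small q : seq nat :=
  nseq (3 * q) 0 ++ nseq (3 * q) 1 ++ nseq (3 * q) 2 ++
  flatten [seq nseq (6 - q * specials q.-1 c) (c + 3) | c <- iota 0 q].
(** The three pair colors are left out of the fourth class, whose other colors occur 3 times each.
    Class sizes 10, 10, 10, 12 give degree ratio [30/42]; below, 11, 11, 11, 15 give [33/48]. *)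
Definition pattern7 : seq nat := nseq 10 0 ++ nseq 10 1 ++ nseq 10 2 ++
  flatten [seq nseq 3 (c + 3) | c <- iota 3 4].
Definition pattern8 : seq nat := nseq 11 0 ++ nseq 11 1 ++ nseq 11 2 ++
  flatten [seq nseq 3 (c + 3) | c <- iota 3 5].

Lemma pattern_small_ok q : 2 <= q <= 6 -> balanced_pattern q.-1 (pattern_small q) 3 4.
Proof. by case: q => [|[|[|[|[|[|[|]]]]]]] // _; vm_compute. Qed.

Lemma pattern7_ok : balanced_pattern 6 pattern7 5 7.
Proof. by vm_compute. Qed.

Lemma pattern8_ok : balanced_pattern 7 pattern8 11 16.
Proof. by vm_compute. Qed.

Section IndependentSet.
Variable K : nat.

Definition indep_adj : rel 'I_(3 * K) := fun x y => (x != y) && ~~ ((x <= K) && (y <= K)).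

Lemma indep_adj_sym : symmetric indep_adj.
Proof. by move=> x y; rewrite /indep_adj eq_sym [(x <= K) && _]andbC. Qed.

Lemma indep_adj_irr : irreflexive indep_adj.
Proof. by move=> x; rewrite /indep_adj eqxx. Qed.

Definition indep_graph : sgraph 'I_(3 * K) := SGraph indep_adj_sym indep_adj_irr.

Lemma card_low : 0 < K -> #|[set x : 'I_(3 * K) | x <= K]| = K.+1.
Proof.
move=> K0; have KK : K.+1 <= 3 * K by move: K0; clear; lia.
have winj : injective (widen_ord KK) by move=> a b /(congr1 val) /= h; apply: val_inj.
rewrite -[RHS]card_ord -cardsT -(card_imset _ winj); apply: eq_card => x.
rewrite inE; apply/idP/imsetP => [xK|[y _ ->]]; last by rewrite /= -ltnS ltn_ord.
by exists (Ordinal (xK : x < K.+1)) => //; apply: val_inj.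
Qed.

(** A tiling has [K] triangles, each with at most one of the [K + 1] independent vertices. *)
Lemma indep_no_tiling P : 0 < K -> ~ is_Kr_tiling indep_graph 3 P.
Proof.
move=> K0 /andP[pP /forall_inP clP].
have cP : #|P| = K.
  have := card_partition pP; rewrite cardsT card_ord.
  rewrite (eq_bigr (fun=> 3)) => [|B /clP /andP[/eqP //]].
  by rewrite sum_nat_const; clear; lia.
pose Z := [set x : 'I_(3 * K) | x <= K].
have : #|Z| <= #|P|.
  rewrite -sum1_card big_mkcond /= (eq_bigl (mem [set: 'I_(3 * K)])) => [|x]; last by rewrite !inE.
  rewrite (set_partition_big _ pP) /= -[X in _ <= X]sum1_card; apply: leq_sum => B BP.
  rewrite -big_mkcondr /= sum1_card; apply/card_le1_eqP => x y hx hy.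
  have /andP[xB xZ] : (x \in B) && (x \in Z) := hx.
  have /andP[yB yZ] : (y \in B) && (y \in Z) := hy.
  apply/eqP/negPn/negP => xy.
  have /andP[_ /forall_inP cl] := clP B BP.
  have /forall_inP/(_ x xB)/implyP/(_ xy) := cl y yB.
  by move: xZ yZ; rewrite !inE /= /indep_adj => -> ->; rewrite andbF.
by rewrite card_low // cP ltnn.
Qed.

Lemma indep_degree v : 0 < K -> 2 * K <= (degree indep_graph v).+1.
Proof.
move=> K0; have : 3 * K <= degree indep_graph v + K.+1.
  rewrite -{1}[3 * K]card_ord -cardsT -card_low //.
  case: (leqP v K) => vK.
    apply: leq_trans (leq_card_setU _ _); apply/subset_leq_card/subsetP => w _.
    rewrite !inE /= /indep_adj vK /=; case: (leqP w K) => wK; rewrite ?orbT // orbF andbT.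
    by apply: contraTneq vK => ->; rewrite -ltnNge.
  apply: leq_trans (_ : degree indep_graph v + #|[set v]| <= _); last first.
    by rewrite leq_add2l cards1 card_low.
  apply: leq_trans (leq_card_setU _ _); apply/subset_leq_card/subsetP => w _.
  rewrite !inE /= /indep_adj [v <= K]leqNgt vK /= andbT.
  by rewrite [w == v]eq_sym; case: (v == w).
by clear; lia.
Qed.
End IndependentSet.

From mathcomp Require Import classical_sets reals.

(** * Discrepancy and the thresholds *)

Section Threshold.
Variable R : realType.
Local Open Scope ring_scope.

Lemma discrepancy_ge (V : finType) (G : sgraph V) q (f : {set V} -> 'I_q) P c (x : nat) :
  is_Kr_tiling G 3 P -> (#|V| + x <= q * #|color_class (tiling_graph P) f c|)%N ->
  x%:R <= discrepancy R (tiling_graph P) f.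
Proof.
move=> tP h; have q0 : (0 < q)%N by exact: leq_ltn_trans (leq0n c) (ltn_ord c).
have q0' : 0 < q%:R :> R by rewrite ltr0n.
apply: ub_le_sup; last first.
  by exists c; rewrite (card_edges_Kr3 tP) ler_pdivrMr // -natrD -natrM ler_nat mulnC.
exists (q * #|V|)%:R => t [c' hc']; move: hc'; rewrite (card_edges_Kr3 tP) ler_pdivrMr //.
have : (#|color_class (tiling_graph P) f c'| <= #|V|)%N.
  rewrite -(card_edges_Kr3 tP); apply/subset_leq_card/fintype.subsetP => e.
  by rewrite inE => /andP[].
move=> hle hc'; have : (#|color_class (tiling_graph P) f c'|%:R * q%:R : R) <= (q * #|V|)%:R.
  by rewrite -natrM ler_nat mulnC leq_mul2l hle orbT.
by move=> h2; have := ler0n R #|V|; lra.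
Qed.

Lemma discrepancy_le0 (V : finType) (G : sgraph V) q (f : {set V} -> 'I_q) P :
  is_Kr_tiling G 3 P ->
  (forall c, (q * #|color_class (tiling_graph P) f c| <= #|V|)%N) ->
  discrepancy R (tiling_graph P) f <= 0.
Proof.
move=> tP h; pose c0 := f finset.set0.
have q0 : (0 < q)%N by exact: leq_ltn_trans (leq0n c0) (ltn_ord c0).
have q0' : 0 < q%:R :> R by rewrite ltr0n.
apply: ge_sup.
  by exists (- #|V|%:R); exists c0; rewrite (card_edges_Kr3 tP) subrr mul0r ler0n.
move=> t [c hc]; move: hc; rewrite (card_edges_Kr3 tP) ler_pdivrMr // -natrM mulnC.
have := h c; rewrite -(ler_nat R); move: ((q * _)%N%:R) (#|V|%:R) => x y; lra.
Qed.

Lemma threshold_eq q (delta0 : R) : 0 < delta0 ->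
  (forall delta, delta0 < delta -> forces_discrepancy 3 q delta) ->
  (forall delta, delta < delta0 -> 0 < delta -> ~ forces_discrepancy 3 q delta) ->
  delta_threshold R 3 q = delta0.
Proof.
move=> d0 up low; apply/eqP; rewrite eq_le; apply/andP; split.
  apply/ler_addgt0Pr => e e0; apply: ge_inf.
    by exists 0 => x [/ltW].
  by split; [apply: addr_gt0 | apply: up; rewrite ltrDl].
apply: lb_le_inf.
  by exists (delta0 + 1); split; [apply: addr_gt0 | apply: up; rewrite ltrDl].
by move=> x [x0 fx]; rewrite leNgt; apply/negP => /low /(_ x0).
Qed.

Lemma pattern_not_forced q' pat num den (delta : R) : balanced_pattern q' pat num den ->
  (0 < den)%N -> (num <= den)%N -> delta <= num%:R / den%:R ->
  ~ forces_discrepancy 3 q'.+1 delta.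
Proof.
move=> ok den0 nd hd [zeta z0 [N hN]]; pose k := (3 * N.+1)%N; pose n := (size pat * k)%N.
have M0 : (0 < size pat)%N by case/and4P: ok.
have kn : (k <= n)%N by rewrite leq_pmull.
have [|||P tP] := hN n _ _ (pattern_graph pat k) _ (pattern_color q' (pat := pat) (k := k)).
- by apply: leq_trans kn; rewrite /k; clear; lia.
- by rewrite dvdn_mull // dvdn_mulr.
- have h : (num * n <= den * min_degree (pattern_graph pat k))%N.
    apply: (min_degree_ind (Q := fun x => num * n <= den * x)%N).
      (* The minimum has the order of the graph as its unit, so the bound is needed for this value
         too; here [num <= den] enters. *)
      by rewrite card_ord leq_mul2r nd orbT.
    by move=> v; apply: pattern_degree ok.
  have den0' : 0 < den%:R :> R by rewrite ltr0n.
  apply: le_trans (_ : num%:R / den%:R * n%:R <= _).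
    by apply: ler_wpM2r.
  by rewrite mulrAC ler_pdivrMr // -!natrM ler_nat [X in (_ <= X)%N]mulnC.
have := @discrepancy_le0 _ _ _ (pattern_color q' (pat := pat) (k := k)) _ tP.
move=> h; rewrite leNgt => /negP; apply; apply: le_lt_trans (h _) _.
  by move=> c; rewrite (pattern_balanced c ok tP) card_ord.
by rewrite mulr_gt0 // ltr0n; apply: leq_trans kn.
Qed.

Lemma nat_upper_bound (x : R) : exists m : nat, (0 < m)%N /\ x <= m%:R.
Proof.
exists (Num.truncn `|x|).+1; split => //.
by apply: le_trans (ler_norm x) _; apply: ltW; apply: truncnS_gt.
Qed.

Lemma not_forced_below q (delta : R) : (0 < q)%N -> 0 < delta -> delta < 2 / 3 ->
  ~ forces_discrepancy 3 q delta.
Proof.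
case: q => // q' _ d0 hd [zeta z0 [N hN]].
have e0 : 0 < 2 - 3 * delta by lra.
have [m [m0 hm]] := nat_upper_bound (1 / (2 - 3 * delta)).
(* With [m] at least [1/(2 - 3 delta)], the degree [2K - 1] is still at least [3 delta K]. *)
pose K := (N + m)%N; have K0 : (0 < K)%N by rewrite addn_gt0 m0 orbT.
have [|||P tP _] := hN (3 * K)%N _ _ (indep_graph K) _ (fun=> ord0).
- by rewrite /K; lia.
- exact: dvdn_mulr.
- have h : (2 * K <= (min_degree (indep_graph K)).+1)%N.
    apply: (min_degree_ind (Q := fun x => 2 * K <= x.+1)%N).
      by rewrite card_ord; lia.
    by move=> v; apply: indep_degree.
  have : 1 <= K%:R * (2 - 3 * delta).
    rewrite -ler_pdivrMr //; apply: le_trans hm _; rewrite ler_nat /K; lia.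
  move: h; move: (min_degree _) => md.
  by rewrite -(ler_nat R) -[md.+1]addn1 !natrM natrD; lra.
exact: (indep_no_tiling K0 tP).
Qed.

Lemma forces_of q (delta : R) h S : (0 < h)%N -> (0 < S)%N ->
  (forall n d e : nat, (0 < n)%N -> (S * e <= n)%N -> delta * n%:R <= d%:R ->
    [/\ ((2 * h + 1) * n <= 3 * h * d)%N, (72 * h * (q * e) <= n)%N &
      ((forall x, 2 * (d - 12 * (q * e)) <= n + 3 * x -> n + e <= q * x)%N \/
       ((3 * n < 4 * (d - 12 * (q * e)))%N /\
        forall x, 2 * (d - 12 * (q * e)) <= n + x -> n + e <= q * x)%N)]) ->
  forces_discrepancy 3 q delta.
Proof.
move=> h0 S0 H; have [N HN] := tiling_with_frequent_color q h0.
have S2 : 0 < (2 * S)%:R :> R by rewrite ltr0n muln_gt0.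
exists (2 * S)%:R^-1; first by rewrite invr_gt0.
exists (N + 2 * S)%N => n hn d3 G hd f.
have n0 : (0 < n)%N by apply: leq_trans hn; rewrite addn_gt0 muln_gt0 S0 orbT.
pose e := (n %/ S)%N.
have eS : (S * e <= n)%N by rewrite mulnC leq_trunc_div.
have [H1 H2 H3] := H n (min_degree G) e n0 eS hd.
have dg_deg v : dg G [set: 'I_n]%SET v = degree G v.
  by apply: eq_card => w; rewrite !inE.
have [s [c [ts hc]]] :
    exists s c, tiles G s [set: 'I_n]%SET /\ (n + e <= q * cnt f c s)%N.
  have [||v|||s [ts hs]] := HN 'I_n G f (min_degree G) e; rewrite ?card_ord //.
  - by apply: leq_trans hn; rewrite leq_addr.
  - by rewrite dg_deg; apply: min_degree_le.
  rewrite card_ord in hs; case: hs => [[c hc]|[[c hc] hs]]; first by exists s, c.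
  case: H3 => [H3|[H3 H4]]; first by exists s, c; split=> //; apply: H3.
  by have [c' [s' [ts' hc']]] := hs H3; exists s', c'; split=> //; apply: H4.
exists (blocks s); first exact: blocks_tiling.
apply: le_trans (_ : e%:R <= _); last first.
  apply: (discrepancy_ge (c := c) (blocks_tiling ts)).
  by rewrite card_ord (card_color_blocks f c ts).
rewrite mulrC ler_pdivrMr // -natrM ler_nat.
have : (n < e.+1 * S)%N by apply: ltn_ceil.
have : (0 < e)%N by rewrite divn_gt0 //; move: hn; lia.
by move: (e) => e'; clear => h1 h2; nia.
Qed.

(** [(2d - n)/3] exceeds [n/q] exactly for [d > (q + 3)n/(2q)], that is, for positive [kap]. [S1]
    makes [kap * n] cover the loss [24 q^2 e] from the gadgets plus [3e] for the excess. *)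
Lemma forces_sparse q (delta : R) : (0 < q)%N -> 2 / 3 < delta ->
  (q%:R + 3) / (2 * q%:R) < delta -> forces_discrepancy 3 q delta.
Proof.
move=> q0 d23 dq; have q0' : 0 < q%:R :> R by rewrite ltr0n.
have [h [h0 hh]] := nat_upper_bound (1 / (3 * (delta - 2 / 3))).
have k0 : 0 < q%:R * (2 * delta - 1) - 3.
  by move: dq; rewrite ltr_pdivrMr; [lra | lra].
set kap := q%:R * (2 * delta - 1) - 3 in k0.
have [S1 [S10 hS]] := nat_upper_bound ((24 * q%:R * q%:R + 3) / kap).
have hh' : 1 <= h%:R * (3 * (delta - 2 / 3)) by rewrite -ler_pdivrMr //; lra.
have hS' : 24 * q%:R * q%:R + 3 <= S1%:R * kap by rewrite -ler_pdivrMr.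
apply: (@forces_of q delta h (S1 + 72 * h * q)) => //; first by rewrite addn_gt0 S10.
move=> n d e n0 eS hd; have n0' : 0 <= n%:R :> R by rewrite ler0n.
split.
- rewrite -(ler_nat R) !natrM natrD natrM.
  have h1 := ler_wpM2r n0' hh'.
  have h2 : 3 * h%:R * (delta * n%:R) <= 3 * h%:R * d%:R by rewrite ler_wpM2l // mulr_ge0.
  by lra.
- by apply: leq_trans eS; rewrite mulnA leq_mul2r leq_addl orbT.
left=> x hx; have hx' : (2 * d <= n + 3 * x + 24 * (q * e))%N by move: hx; clear; lia.
have eS1 : (S1 * e <= n)%N by apply: leq_trans eS; rewrite leq_mul2r leq_addr orbT.
move: hx' eS1; rewrite -!(ler_nat R) !natrD !natrM => hx' eS1.
have e0' : 0 <= e%:R :> R by rewrite ler0n.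
have h1 := ler_wpM2r e0' hS'.
have h2 : kap * (S1%:R * e%:R) <= kap * n%:R by rewrite ler_wpM2l // ltW.
have h3 := ler_wpM2l (ltW q0') hx'.
have h4 : q%:R * (2 * (delta * n%:R)) <= q%:R * (2 * d%:R) by rewrite !ler_wpM2l // ltW.
by rewrite /kap in h1 h2; lra.
Qed.

(** Above [3/4] the stronger bound [2d - n > n/2] suffices for all [q >= 2]. [S1] again covers
    gadgets and excess, [S2] keeps the degree above [3n/4] after removal of the gadgets, and [h = 4]
    fits since [2/3 + 1/12 = 3/4]. *)
Lemma forces_dense q (delta : R) : (2 <= q)%N -> 3 / 4 < delta -> forces_discrepancy 3 q delta.
Proof.
move=> q2 d34; have q0' : 2 <= q%:R :> R by rewrite ler_nat.
have k0 : 0 < 4 * delta - 3 by lra.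
have k1 : 0 < q%:R * (2 * delta - 1) - 1.
  have : 2 * (2 * delta - 1) <= q%:R * (2 * delta - 1) by rewrite ler_wpM2r //; lra.
  by lra.
set kap := q%:R * (2 * delta - 1) - 1 in k1.
have [S1 [S10 hS]] := nat_upper_bound ((24 * q%:R * q%:R + 1) / kap).
have [S2 [S20 hS2]] := nat_upper_bound ((48 * q%:R + 1) / (4 * delta - 3)).
have hS' : 24 * q%:R * q%:R + 1 <= S1%:R * kap by rewrite -ler_pdivrMr.
have hS2' : 48 * q%:R + 1 <= S2%:R * (4 * delta - 3) by rewrite -ler_pdivrMr.
apply: (@forces_of q delta 4 (S1 + S2 + 72 * 4 * q)) => //; first by rewrite !addn_gt0 S10.
move=> n d e n0 eS hd; have n0' : 0 < n%:R :> R by rewrite ltr0n.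
have e0' : 0 <= e%:R :> R by rewrite ler0n.
have hdn : 3 / 4 * n%:R <= d%:R :> R.
  have h34 : 3 / 4 * n%:R <= delta * n%:R :> R by rewrite ler_wpM2r // ltW.
  exact: le_trans h34 hd.
split.
- by rewrite -(ler_nat R) !natrM; lra.
- by apply: leq_trans eS; rewrite mulnA leq_mul2r leq_addl orbT.
right; split.
  have eS2 : (S2 * e <= n)%N.
    by apply: leq_trans eS; rewrite leq_mul2r -addnA addnCA leq_addr orbT.
  suff : (3 * n + 48 * (q * e) < 4 * d)%N by clear; lia.
  move: eS2; rewrite -(ler_nat R) -(ltr_nat R) natrD !natrM => eS2.
  have h1 := ler_wpM2r e0' hS2'.
  have h2 : (4 * delta - 3) * (S2%:R * e%:R) <= (4 * delta - 3) * n%:R by rewrite ler_wpM2l // ltW.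
  have h3 : 0 < (4 * delta - 3) * n%:R by rewrite mulr_gt0.
  case: (posnP e) => [e00|epos]; first by rewrite e00 in h1 h2 *; lra.
  have : 0 < e%:R :> R by rewrite ltr0n.
  by lra.
move=> x hx; have hx' : (2 * d <= n + x + 24 * (q * e))%N by move: hx; clear; lia.
have eS1 : (S1 * e <= n)%N.
  by apply: leq_trans eS; rewrite leq_mul2r -addnA leq_addr orbT.
move: hx' eS1; rewrite -!(ler_nat R) !natrD !natrM => hx' eS1.
have h1 := ler_wpM2r e0' hS'.
have h2 : kap * (S1%:R * e%:R) <= kap * n%:R by rewrite ler_wpM2l // ltW.
have q0 : 0 <= q%:R :> R by rewrite ler0n.
have h3 := ler_wpM2l q0 hx'.
have h4 : q%:R * (2 * (delta * n%:R)) <= q%:R * (2 * d%:R) by rewrite !ler_wpM2l.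
by rewrite /kap in h1 h2; lra.
Qed.
End Threshold.

Local Open Scope ring_scope.

Theorem theorem1p7 (R : realType) :
  (forall q : nat, (2 <= q <= 6)%N -> delta_threshold R 3 q = 3 / 4) /\
  delta_threshold R 3 7 = 5 / 7 /\
  delta_threshold R 3 8 = 11 / 16 /\
  (forall q : nat, (9 <= q)%N -> delta_threshold R 3 q = 2 / 3).
Proof.
split; [move=> q hq | split; [|split]].
- apply: threshold_eq; [lra| |] => delta hd.
    by apply: forces_dense => //; case/andP: hq.
  move=> _; have := pattern_small_ok hq; case: q hq => // q' _ ok.
  by apply: (pattern_not_forced ok) => //; apply: ltW.
- apply: threshold_eq; [lra| |] => delta hd.
    (* For [q = 7] the bound [(q + 3)/(2q)] is [5/7], for [q = 8] it is [11/16]; both exceed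
       [2/3]. *)
    by apply: forces_sparse => //; lra.
  by move=> _; apply: (pattern_not_forced pattern7_ok) => //; apply: ltW.
- apply: threshold_eq; [lra| |] => delta hd.
    by apply: forces_sparse => //; lra.
  by move=> _; apply: (pattern_not_forced pattern8_ok) => //; apply: ltW.
move=> q q9; have q9' : 9 <= q%:R :> R by rewrite ler_nat.
apply: threshold_eq; [lra| |] => delta hd.
  apply: forces_sparse => //; first by apply: leq_trans q9.
  (* From [q = 9] on, [(q + 3)/(2q)] is at most [2/3], so the existence of tilings is the only
     obstacle. *)
  by apply: le_lt_trans hd; rewrite ler_pdivrMr; lra.
by move=> d0; apply: not_forced_below => //; apply: leq_trans q9.
Qed.
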